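(* For every $d\ge 1$, every B-tiling in $\mathbb H^{d+1}$ is non-crystallographic.
   Context: Use the upper half-space model $\mathbb H^{d+1}=\{(x,y): x\in\mathbb R^d,\ y>0\}$ with metric $(|dx|^2+dy^2)/y^2$. The Böröczky prototile is $B=[-\tfrac12,\tfrac12]^d\times[\tfrac12,1]$. Its facets are: one $a$-facet $[-\tfrac12,\tfrac12]^d\times\{1\}$ (a unit Euclidean cube in a horosphere); $2^d$ $b$-facets $\{(x,\tfrac12): x\in[-\tfrac12,\tfrac12]^d,\ x_i\sigma_i\ge 0 \text{ for all } i\}$, one for each $\sigma\in\{-1,1\}^d$ (unit Euclidean cubes in a concentric horosphere at distance $\ln 2$); and $2d$ $c$-facets, $F\times[\tfrac12,1]$ with $F$ a facet of $[-\tfrac12,\tfrac12]^d$. The lower-dimensional faces of $B$ are the faces of the cubes that are $a$- or $b$-facets, and the sets $F\times[\tfrac12,1]$ with $F$ a face of $[-\tfrac12,\tfrac12]^d$ of dimension less than $d-1$. A B-tiling is a tiling of $\mathbb H^{d+1}$ by isometric copies of $B$ which is face-to-face (the intersection of any two tiles is empty or a common face of both); when $d=1$ it is also required that whenever two tiles share a $c$-edge, the orientations of that edge induced by the two tiles (from the $a$-edge towards the $b$-edges) agree. A tiling is crystallographic if its symmetry group (the group of all isometries mapping the tiling to itself) has a compact fundamental domain. *)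

(* Defs.v *)
From HB Require Import structures.
From mathcomp Require Import all_boot all_order all_algebra.
From mathcomp Require Import all_classical all_reals all_analysis.
Import Order.TTheory GRing.Theory Num.Theory.
Import numFieldNormedType.Exports.

Set Implicit Arguments.
Unset Strict Implicit.
Unset Printing Implicit Defensive.

Local Open Scope classical_set_scope.
Local Open Scope ring_scope.

Section UpperHalfSpace.
Variables (R : realType) (d : nat).

Definition half_space : set ('rV[R]_d * R) := [set p | 0 < p.2].

(* The points of hyperbolic (d+1)-space.  A set_type carries the subspace
   topology, which is the manifold topology of the model; compactness and
   interiors of sets of points refer to it. *)
Definition hyp : Type := set_type half_space.

(* Norm of the velocity of g at time t for the metric (|dx|^2 + dy^2) / y^2.
   The sum of squares is spelled out because the library norm on 'rV[R]_d and
   on products is the maximum norm. *)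
Definition hyp_speed (g : R -> 'rV[R]_d * R) (t : R) : R :=
  Num.sqrt (\sum_(i < d) (derive1 g t).1 0 i ^+ 2 + (derive1 g t).2 ^+ 2) / (g t).2.

Definition hyp_length (g : R -> 'rV[R]_d * R) : R :=
  \int[lebesgue_measure]_(t in `[0, 1]) hyp_speed g t.

(* C^1 curves in the half-space parametrized by [0, 1]; they are taken with a
   C^1 extension to the whole line, which always exists, and nothing is
   required of the extension outside [0, 1]. *)
Definition hyp_curve (p q : hyp) (g : R -> 'rV[R]_d * R) : Prop :=
  [/\ forall t, derivable g t 1, continuous (derive1 g),
      forall t : R, 0 <= t <= 1 -> half_space (g t),
      g 0 = set_val p & g 1 = set_val q].

Definition hyp_dist (p q : hyp) : R :=
  inf [set hyp_length g | g in hyp_curve p q].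

Definition hyp_isometry (f : hyp -> hyp) : Prop :=
  bijective f /\ forall p q, hyp_dist (f p) (f q) = hyp_dist p q.

Definition hyp_prod (A : set 'rV[R]_d) (I : set R) : set hyp :=
  [set p | A (set_val p).1 /\ I (set_val p).2].

End UpperHalfSpace.

Section Prototile.
Variables (R : realType) (d : nat).

Definition box (l u : 'rV[R]_d) : set 'rV[R]_d :=
  [set x | forall i, l 0 i <= x 0 i <= u 0 i].

(* The k-dimensional faces of the box with l < u coordinatewise: in each
   coordinate keep the whole side (None) or one of its two endpoints
   (Some false: the lower one, Some true: the upper one). *)
Definition box_face (l u : 'rV[R]_d) (k : nat) (F : set 'rV[R]_d) : Prop :=
  exists s : 'I_d -> option bool,
    #|[pred i | s i == None]| = k /\
    F = box (\row_i (if s i == Some true then u 0 i else l 0 i))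
            (\row_i (if s i == Some false then l 0 i else u 0 i)).

Definition cube_lo : 'rV[R]_d := const_mx (- 2^-1).
Definition cube_hi : 'rV[R]_d := const_mx 2^-1.
Definition cube : set 'rV[R]_d := box cube_lo cube_hi.
Definition cube_face (k : nat) (F : set 'rV[R]_d) : Prop :=
  box_face cube_lo cube_hi k F.

(* The part of the cube in the closed orthant of sign vector sg, where true
   stands for +1 and false for -1. *)
Definition orthant_lo (sg : 'I_d -> bool) : 'rV[R]_d :=
  \row_i (if sg i then 0 else - 2^-1).
Definition orthant_hi (sg : 'I_d -> bool) : 'rV[R]_d :=
  \row_i (if sg i then 2^-1 else 0).
Definition orthant_face sg (k : nat) (F : set 'rV[R]_d) : Prop :=
  box_face (orthant_lo sg) (orthant_hi sg) k F.

Lemma orthant_boxE (sg : 'I_d -> bool) :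
  box (orthant_lo sg) (orthant_hi sg) =
  [set x | cube x /\ forall i, 0 <= x 0 i * (if sg i then 1 else - 1)].
Proof.
have h0 : (0 : R) <= 2^-1 by rewrite invr_ge0.
have h1 : - (2^-1 : R) <= 0 by rewrite oppr_le0.
apply/seteqP; split=> x /= H.
  by split=> i; have := H i; rewrite !mxE; case: (sg i) => /andP[a b];
    rewrite ?mulr1 ?mulrN1 ?oppr_ge0 ?(le_trans h1 a) ?(le_trans b h0) ?a ?b.
move: H => [C S] i; have := C i; have := S i.
by rewrite !mxE; case: (sg i);
   rewrite ?mulr1 ?mulrN1 ?oppr_ge0 => -> /andP[a b]; rewrite ?a ?b.
Qed.

Definition prototile : set (hyp R d) := hyp_prod cube `[2^-1, 1].

(* In the first two cases k = d gives the a-facet and the b-facets; in the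
   third one k = d - 1 gives the c-facets. *)
Definition prototile_face (E : set (hyp R d)) : Prop :=
  [\/ exists k F, cube_face k F /\ E = hyp_prod F [set 1],
      exists sg k F, orthant_face sg k F /\ E = hyp_prod F [set 2^-1]
    | exists k F, [/\ (k < d)%N, cube_face k F
                    & E = hyp_prod F `[2^-1, 1]]].

End Prototile.

Section Tilings.
Variables (R : realType) (d : nat).
Implicit Types (t E : set (hyp R d)) (T : set (set (hyp R d))).

Definition is_tile t : Prop :=
  exists2 g, hyp_isometry g & t = g @` @prototile R d.

Definition tile_face t E : Prop :=
  exists g F, [/\ hyp_isometry g, t = g @` @prototile R d,
                  prototile_face F & E = g @` F].

Definition tiling T : Prop :=
  [/\ forall t, T t -> is_tile t,
      \bigcup_(t in T) t = setT
    & forall t t', T t -> T t' -> t <> t' -> t° `&` t'° = set0].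

Definition face_to_face T : Prop :=
  forall t t', T t -> T t' -> t <> t' ->
    t `&` t' = set0 \/ (tile_face t (t `&` t') /\ tile_face t' (t `&` t')).

(* Only used for d = 1, where the 0-dimensional faces F of the cube are its two
   endpoints and hyp_prod F `[2^-1, 1] is a c-edge, oriented from its endpoint
   at height 1 (on the a-edge) to its endpoint at height 1/2. *)
Definition c_edges_agree T : Prop :=
  forall (g h : hyp R d -> hyp R d) (F F' : set 'rV[R]_d),
    hyp_isometry g -> hyp_isometry h ->
    T (g @` @prototile R d) -> T (h @` @prototile R d) ->
    g @` @prototile R d <> h @` @prototile R d ->
    cube_face 0 F -> cube_face 0 F' ->
    g @` hyp_prod F `[2^-1, 1] = h @` hyp_prod F' `[2^-1, 1] ->
    g @` hyp_prod F [set 1] = h @` hyp_prod F' [set 1] /\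
    g @` hyp_prod F [set 2^-1] = h @` hyp_prod F' [set 2^-1].

Definition B_tiling T : Prop :=
  [/\ tiling T, face_to_face T & d = 1%N -> c_edges_agree T].

Definition symmetry_group T : set (hyp R d -> hyp R d) :=
  [set g | hyp_isometry g /\ [set g @` t | t in T] = T].

Definition fundamental_domain (G : set (hyp R d -> hyp R d))
    (D : set (hyp R d)) : Prop :=
  \bigcup_(g in G) (g @` D) = setT /\
  forall g h, G g -> G h -> g <> h -> (g @` D)° `&` (h @` D)° = set0.

Definition crystallographic T : Prop :=
  exists D, compact D /\ fundamental_domain (symmetry_group T) D.

End Tilings.

(* Main.v *)
(** The hyperboloid model linearizes the geometry: cosh of the distance is, up
    to sign, the Lorentzian product, so isometries act linearly on the functions
    [hlin a b c], among which are [1 / height] and [x_i / height].  The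
    coordinates of an isometry can therefore be controlled from its effect on a
    single face: the points of a b-facet span the whole space and [1 / height]
    is constant on it, so a facet glued below a b-facet is either a b-facet,
    whose tile would lie above it as well, or an a-facet.  Hence below each
    b-facet of a tile hangs a copy of the tile, a child, and each tile is the
    child of at most one tile.

    With a compact fundamental domain there are finitely many orbits of tiles.
    Choosing a child in each orbit gives an injective, hence surjective, map on
    orbits, so all children of a tile lie in the same orbit, and so do all its
    grandchildren.  A symmetry between two grandchildren fixes their common
    grandparent, hence the centre of its base and the axis above and below it;
    but some grandchildren meet that axis and others do not. *)
From HB Require Import structures.
From mathcomp Require Import all_boot all_order all_algebra.
From mathcomp Require Import all_classical all_reals all_analysis.
From mathcomp Require Import ring lra.
Require Import Defs.
Import Order.TTheory GRing.Theory Num.Theory.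
Import numFieldNormedType.Exports.

Set Implicit Arguments.
Unset Strict Implicit.
Unset Printing Implicit Defensive.

Local Open Scope classical_set_scope.
Local Open Scope ring_scope.

(** * The upper half-space and the hyperboloid *)

Section Dot.
Variables (R : realType) (d : nat).
Implicit Types u v w : 'rV[R]_d.

Definition dot u v : R := \sum_i u 0 i * v 0 i.

Lemma dotC u v : dot u v = dot v u.
Proof. by apply: eq_bigr => i _; rewrite mulrC. Qed.

Lemma dotDl u v w : dot (u + v) w = dot u w + dot v w.
Proof. by rewrite -big_split; apply: eq_bigr => i _; rewrite mxE mulrDl. Qed.

Lemma dotZl k u v : dot (k *: u) v = k * dot u v.
Proof. by rewrite mulr_sumr; apply: eq_bigr => i _; rewrite mxE mulrA. Qed.

Lemma dotDr u v w : dot u (v + w) = dot u v + dot u w.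
Proof. by rewrite dotC dotDl !(dotC u). Qed.

Lemma dotZr k u v : dot u (k *: v) = k * dot u v.
Proof. by rewrite dotC dotZl dotC. Qed.

Lemma dotNl u v : dot (- u) v = - dot u v.
Proof. by rewrite -scaleN1r dotZl mulN1r. Qed.

Lemma dotNr u v : dot u (- v) = - dot u v.
Proof. by rewrite dotC dotNl dotC. Qed.

Lemma dot0l u : dot 0 u = 0.
Proof. by rewrite -(scale0r 0) dotZl mul0r. Qed.

Lemma dot0r u : dot u 0 = 0.
Proof. by rewrite dotC dot0l. Qed.

Definition dotE := (dotDl, dotDr, dotNl, dotNr, dotZl, dotZr, dot0l, dot0r).

Lemma dot_deltal i u : dot (delta_mx 0 i) u = u 0 i.
Proof.
rewrite /dot (bigD1 i) //= mxE !eqxx mul1r big1 ?addr0 // => j /negPf ji.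
by rewrite mxE ji andbF mul0r.
Qed.

Lemma dot_deltar i u : dot u (delta_mx 0 i) = u 0 i.
Proof. by rewrite dotC dot_deltal. Qed.

Lemma dot_ge0 u : 0 <= dot u u.
Proof. by apply: sumr_ge0 => i _; rewrite -expr2 sqr_ge0. Qed.

Lemma dot_eq0 u : dot u u = 0 -> u = 0.
Proof.
move=> u0; apply/rowP => i; rewrite mxE; apply/eqP.
rewrite -sqrf_eq0 expr2.
apply/eqP; apply: (psumr_eq0P _ u0) => // j _.
by rewrite -expr2 sqr_ge0.
Qed.

Lemma dot_entry u i : u 0 i ^+ 2 <= dot u u.
Proof.
rewrite /dot (bigD1 i) //= -expr2 lerDl.
by apply: sumr_ge0 => j _; rewrite -expr2 sqr_ge0.
Qed.

(** Cauchy-Schwarz for the vectors (u, s) and (v, t): N times the defect is the squared norm of N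
    (u, s) - D (v, t). *)
Lemma dot_CauchySchwarz u v s t :
  (dot u v + s * t) ^+ 2 <= (dot u u + s ^+ 2) * (dot v v + t ^+ 2).
Proof.
have v0 := dot_ge0 v; have u0 := dot_ge0 u.
set N := dot v v + t ^+ 2; set D := dot u v + s * t.
have N0 : 0 <= N by rewrite addr_ge0 ?sqr_ge0.
have [Nz|Nz] := eqVneq N 0.
  have tz : t = 0.
    apply/eqP; rewrite -sqrf_eq0 eq_le sqr_ge0 andbT.
    by move: Nz; rewrite /N => Nz; rewrite -Nz lerDr.
  have vz : v = 0 by apply: dot_eq0; move: Nz; rewrite /N tz expr0n addr0.
  by rewrite /D vz tz dot0r mulr0 addr0 expr0n mulr_ge0 ?addr_ge0 ?sqr_ge0.
have H : 0 <= N * ((dot u u + s ^+ 2) * N - D ^+ 2).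
  have -> : N * ((dot u u + s ^+ 2) * N - D ^+ 2) =
      dot (N *: u - D *: v) (N *: u - D *: v) + (N * s - D * t) ^+ 2.
    by rewrite !dotE (dotC v u) /N /D; ring.
  by rewrite addr_ge0 ?sqr_ge0 ?dot_ge0.
by move: H; rewrite pmulr_rge0 ?lt_def ?Nz // subr_ge0.
Qed.

End Dot.

Section Model.
Variables (R : realType) (d : nat).
Notation hyp := (hyp R d).
Implicit Types (p q r : hyp) (b : 'rV[R]_d).

Definition base p : 'rV[R]_d := (set_val p).1.
Definition height p : R := (set_val p).2.

Lemma height_gt0 p : 0 < height p.
Proof. by have := set_valP p. Qed.

Lemma height_neq0 p : height p != 0.
Proof. by rewrite gt_eqF ?height_gt0. Qed.

Definition mkhyp (x : 'rV[R]_d) (y : R) (y0 : 0 < y) : hyp :=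
  SigSub (mem_set (y0 : half_space (x, y))).

Lemma base_mkhyp x y (y0 : 0 < y) : base (mkhyp x y0) = x.
Proof. by []. Qed.

Lemma height_mkhyp x y (y0 : 0 < y) : height (mkhyp x y0) = y.
Proof. by []. Qed.

Lemma hyp_eqP p q : base p = base q -> height p = height q -> p = q.
Proof.
rewrite /base /height => e1 e2; apply: val_inj; change (set_val p = set_val q).
by rewrite (surjective_pairing (set_val p)) e1 e2 -surjective_pairing.
Qed.

(* The hyperbolic cosine of the distance, and, up to sign, the Lorentzian
   product of the points of the hyperboloid corresponding to p and q. *)
Definition coshd p q : R :=
  (dot (base p - base q) (base p - base q) + height p ^+ 2 + height q ^+ 2) /
  (2 * height p * height q).

(* Restrictions of linear functionals to the hyperboloid; such a functional is
   lightlike when [dot b b = 4 * a * c]. *)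
Definition hlin (a : R) b (c : R) p : R :=
  (a + dot b (base p) + c * (dot (base p) (base p) + height p ^+ 2)) / height p.

Lemma coshdC p q : coshd p q = coshd q p.
Proof.
rewrite /coshd !dotE (dotC (base q) (base p)); field.
by rewrite !height_neq0.
Qed.

Lemma coshdxx p : coshd p p = 1.
Proof. by rewrite /coshd subrr dot0l add0r; field; exact: height_neq0. Qed.

Lemma coshd_ge1 p q : 1 <= coshd p q.
Proof.
have p0 := height_gt0 p; have q0 := height_gt0 q.
rewrite /coshd ler_pdivlMr ?mulr_gt0 // mul1r.
have := dot_ge0 (base p - base q); have := sqr_ge0 (height p - height q); nra.
Qed.

Lemma coshd_eq1 p q : coshd p q = 1 -> p = q.
Proof.
have p0 := height_gt0 p; have q0 := height_gt0 q.
move=> /(congr1 (fun x => x * (2 * height p * height q))).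
rewrite /coshd divfK ?mul1r; last by rewrite !mulf_neq0 ?height_neq0.
move=> E; have D0 := dot_ge0 (base p - base q).
have S0 := sqr_ge0 (height p - height q).
have S1 : (height p - height q) ^+ 2 = 0 by nra.
apply: hyp_eqP.
  by apply/eqP; rewrite -subr_eq0; apply/eqP/dot_eq0; nra.
by apply/eqP; rewrite -subr_eq0 -sqrf_eq0; apply/eqP.
Qed.

Lemma coshd_hlin p q :
  coshd p q = hlin ((dot (base q) (base q) + height q ^+ 2) / (2 * height q))
    (- (height q)^-1 *: base q) (2 * height q)^-1 p.
Proof.
rewrite /coshd /hlin !dotE (dotC (base q) (base p)); field.
by rewrite !height_neq0.
Qed.

(** The discriminant [dot b b - 4 * a * c] is the Lorentzian square of the functional, so it depends
    on q and r only through [coshd q r]. With suitable k and l it vanishes, which produces lightlike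
    functionals. *)
Lemma hlin_coshd2 (k l : R) q r : exists abc : R * 'rV[R]_d * R,
  (forall p, k * coshd p q + l * coshd p r = hlin abc.1.1 abc.1.2 abc.2 p) /\
  dot abc.1.2 abc.1.2 - 4 * abc.1.1 * abc.2 =
    - (k ^+ 2 + l ^+ 2 + 2 * k * l * coshd q r).
Proof.
exists (k * ((dot (base q) (base q) + height q ^+ 2) / (2 * height q)) +
        l * ((dot (base r) (base r) + height r ^+ 2) / (2 * height r)),
        k *: (- (height q)^-1 *: base q) + l *: (- (height r)^-1 *: base r),
        k * (2 * height q)^-1 + l * (2 * height r)^-1); split => [p|] /=.
  by rewrite 2!coshd_hlin /hlin !dotE; field; rewrite !height_neq0.
rewrite /coshd !dotE (dotC (base r) (base q)); field.
by rewrite !height_neq0.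
Qed.

(** By lightlikeness, c times the numerator of [hlin] is a quarter of the squared norm of b + 2 c x,
    plus (c y)^2, so the numerator has the sign of c everywhere. For c = 0 also b vanishes and the
    numerator is a. *)
Lemma hlin_null_gt0 a b c p q : dot b b = 4 * a * c ->
  0 < hlin a b c p -> 0 < hlin a b c q.
Proof.
move=> nul; rewrite /hlin !pmulr_lgt0 ?invr_gt0 ?height_gt0 //.
have [c0|c0] := eqVneq c 0.
  have -> : b = 0 by apply: dot_eq0; rewrite nul c0 mulr0.
  by rewrite c0 !dot0l !mul0r.
have pos r : 0 < c * (a + dot b (base r) +
    c * (dot (base r) (base r) + height r ^+ 2)).
  have := dot_ge0 (b + (2 * c) *: base r).
  rewrite !dotE nul (dotC (base r) b) => H.
  have : 0 < (c * height r) ^+ 2.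
    by rewrite exprn_even_gt0 //= mulf_neq0 ?height_neq0.
  nra.
move=> fp; have := pos p; rewrite (pmulr_lgt0 _ fp) => cp.
by have := pos q; rewrite (pmulr_rgt0 _ cp).
Qed.

End Model.

(** * Lengths of curves and the distance formula *)

Lemma cvg_sumr (R : realType) (T I : Type) (F : set_system T) (FF : Filter F)
    (r : seq I) (f : I -> T -> R) (l : I -> R) :
  (forall i, f i x @[x --> F] --> l i) ->
  \sum_(i <- r) f i x @[x --> F] --> \sum_(i <- r) l i.
Proof. by move=> fl; apply: cvg_big => // x; exact: add_continuous. Qed.

Section DerivativeOfLinearImage.
Variables (R : realType) (V W : normedModType R) (L : V -> W).
Hypothesis L_lin : forall (k : R) x y, L (k *: (x - y)) = k *: (L x - L y).
Hypothesis L_cont : continuous L.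

Lemma is_derive_linear_image (g : R -> V) t : derivable g t 1 ->
  is_derive t (1 : R) (L \o g) (L (derive1 g t)).
Proof.
move=> dg.
have H : h^-1 *: ((L \o g) (h *: (1 : R) + t) - (L \o g) t) @[h --> 0^'] -->
    L (derive1 g t).
  rewrite [X in X @ _](_ : _ = L \o (fun h => h^-1 *: (g (h *: (1 : R) + t) - g t))).
    2: by apply/funext => h /=; rewrite L_lin.
  have dgt : h^-1 *: (g (h *: (1 : R) + t) - g t) @[h --> 0^'] --> derive1 g t.
    by rewrite derive1E; exact: dg.
  by apply: cvg_comp dgt _; exact: L_cont.
apply: DeriveDef; first by apply: cvgP; exact: H.
by rewrite /derive; apply: cvg_lim => //; exact: H.
Qed.

End DerivativeOfLinearImage.

Section Curves.
Variables (R : realType) (d : nat).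
Variable g : R -> 'rV[R]_d * R.
Hypothesis dg : forall t, derivable g t 1.
Hypothesis cg : continuous (derive1 g).

Let X (i : 'I_d) (t : R) : R := (g t).1 0 i.
Let Y (t : R) : R := (g t).2.
Let X' (i : 'I_d) (t : R) : R := (derive1 g t).1 0 i.
Let Y' (t : R) : R := (derive1 g t).2.

Let X_derive i (t : R) : is_derive t (1 : R) (X i) (X' i t).
Proof.
apply: (@is_derive_linear_image R _ _ (fun N : 'rV[R]_d * R => N.1 0 i)) => //.
  by move=> k x y; rewrite !mxE.
move=> N; apply: (@continuous_comp _ _ _ fst (fun M : 'rV[R]_d => M 0 i)).
  exact: cvg_fst.
exact: coord_continuous.
Qed.

Let Y_derive (t : R) : is_derive t (1 : R) Y (Y' t).
Proof.
apply: (@is_derive_linear_image R _ _ (fun N : 'rV[R]_d * R => N.2)) => //.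
by move=> N; exact: cvg_snd.
Qed.

Let X'_cont i : continuous (X' i).
Proof.
move=> t; apply: (@continuous_comp _ _ _ (derive1 g) (fun N => N.1 0 i)).
  exact: cg.
apply: (@continuous_comp _ _ _ fst (fun M : 'rV[R]_d => M 0 i)).
  exact: cvg_fst.
exact: coord_continuous.
Qed.

Let Y'_cont : continuous Y'.
Proof.
move=> t; apply: (@continuous_comp _ _ _ (derive1 g) snd); first exact: cg.
exact: cvg_snd.
Qed.

Let is_derive_cont (f : R -> R) (t df : R) : is_derive t (1 : R) f df -> {for t, continuous f}.
Proof.
by move=> H; apply/differentiable_continuous/derivable1_diffP; case: H.
Qed.

Let X_cont i : continuous (X i).
Proof. by move=> t; apply: is_derive_cont. Qed.

Let Y_cont : continuous Y.
Proof. by move=> t; apply: is_derive_cont. Qed.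

Lemma hyp_speed_continuous (t : R) : Y t != 0 -> {for t, continuous (hyp_speed g)}.
Proof.
move=> Yt; rewrite /hyp_speed.
apply: cvgM; last by apply: cvgV => //; exact: Y_cont.
apply: continuous_cvg; first exact: sqrt_continuous.
apply: cvgD; last by apply: cvgM; exact: Y'_cont.
apply: cvg_sumr => i; apply: cvgM; exact: X'_cont.
Qed.

Variables (a : R) (b : 'rV[R]_d) (c : R).

(** The functional [hlin a b c] along the curve, written out because [g t] need not lie in the
    half-space outside [0, 1]; [f'] is its derivative. *)
Let f (t : R) : R := (a + dot b (g t).1 + c * (dot (g t).1 (g t).1 + Y t ^+ 2)) / Y t.
Let f' (t : R) : R := (dot b (derive1 g t).1 +
  2 * c * (dot (g t).1 (derive1 g t).1 + Y t * Y' t) - f t * Y' t) / Y t.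

Let f_derive (t : R) : Y t != 0 -> is_derive t (1 : R) f (f' t).
Proof.
move=> Yt.
have dB : is_derive t (1 : R) (\sum_i (b 0 i *: X i)) (\sum_i b 0 i *: X' i t).
  by apply: is_derive_sum => i; exact: is_deriveZ.
have dX : is_derive t (1 : R) (\sum_i (X i * X i)) (\sum_i (X i t *: X' i t + X i t *: X' i t)).
  by apply: is_derive_sum => i; exact: is_deriveM.
have dV : is_derive t (1 : R) (fun s => (Y s)^-1) (- (Y t) ^- 2 *: Y' t).
  exact: is_deriveV.
have -> : f = (cst a + (\sum_i (b 0 i *: X i)) +
    c *: (\sum_i (X i * X i) + Y * Y)) * (fun s => (Y s)^-1).
  apply/funext => s; rewrite /f /dot /= !fctE /= !fct_sumE.
  by congr ((_ + _ + _ * (_ + _)) * _).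
have dA := is_deriveD (is_derive_cst a t (1 : R)) dB.
have dC := is_deriveZ c (is_deriveD dX (is_deriveM (Y_derive t) (Y_derive t))).
apply: (is_derive_eq (is_deriveM (is_deriveD dA dC) dV)); rewrite /f' /f.
have -> : \sum_i b 0 i *: X' i t = dot b (derive1 g t).1 by [].
have -> : \sum_i (X i t *: X' i t + X i t *: X' i t) = 2 * dot (g t).1 (derive1 g t).1.
  by rewrite mulr_sumr; apply: eq_bigr => i _; rewrite mulr_natl mulr2n.
have -> : (cst a + \sum_i (b 0 i *: X i) + c *: (\sum_i (X i * X i) + Y * Y)) t =
    a + dot b (g t).1 + c * (dot (g t).1 (g t).1 + Y t ^+ 2).
  by rewrite !fctE /= !fct_sumE.
rewrite /GRing.scale /=; field.
exact: Yt.
Qed.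

Hypothesis bac : dot b b = 4 * a * c.

(** The hyperbolic gradient of the logarithm of a lightlike functional has norm 1. In coordinates,
    [f'] is the Euclidean product of the velocity with a vector (u, s) of norm f, divided by the
    height; Cauchy-Schwarz concludes. *)
Let f'_le t : 0 < Y t -> 0 < f t -> `|f' t| <= hyp_speed g t * f t.
Proof.
move=> Yt ft.
have Y0 : Y t != 0 by rewrite gt_eqF.
have ftE : f t * Y t = a + dot b (g t).1 + c * (dot (g t).1 (g t).1 + Y t ^+ 2).
  by rewrite /f divfK.
set u := b + (2 * c) *: (g t).1; set s := 2 * c * Y t - f t.
have E1 : f' t = (dot u (derive1 g t).1 + s * Y' t) / Y t.
  by rewrite /f' /u /s !dotE; congr (_ / _); ring.
have E2 : dot u u + s ^+ 2 = f t ^+ 2.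
  rewrite /u /s !dotE bac (dotC (g t).1 b).
  transitivity (f t ^+ 2 + 4 * c * (a + dot b (g t).1 +
      c * (dot (g t).1 (g t).1 + Y t ^+ 2) - f t * Y t)); first by ring.
  by rewrite ftE subrr mulr0 addr0.
have sE : hyp_speed g t =
    Num.sqrt (dot (derive1 g t).1 (derive1 g t).1 + Y' t ^+ 2) / Y t.
  by [].
rewrite sE E1 normrM [X in _ <= X]mulrAC (gtr0_norm (_ : 0 < (Y t)^-1)) ?invr_gt0 //.
apply: ler_wpM2r; first by rewrite invr_ge0 ltW.
rewrite -[X in _ <= _ * X](ger0_norm (ltW ft)) -!sqrtr_sqr -sqrtrM; last first.
  by rewrite addr_ge0 ?sqr_ge0 ?dot_ge0.
by rewrite ler_wsqrtr // -E2 [X in _ <= X]mulrC; exact: dot_CauchySchwarz.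
Qed.

Hypothesis gY : forall t : R, 0 <= t <= 1 -> 0 < Y t.
Hypothesis f0 : forall t : R, 0 <= t <= 1 -> 0 < f t.

(** Integration of the preceding bound, by which the derivative of - ln f is at most the speed. This
    is the source of all lower bounds for lengths. *)
Lemma ln_null_le_length : ln (f 0) - ln (f 1) <= hyp_length g.
Proof.
have Y0 t : 0 <= t <= 1 -> Y t != 0 by move=> /gY; rewrite lt0r => /andP[].
have in01 (t : R) : t \in (`[0, 1]%classic : set R) -> 0 <= t <= 1.
  by rewrite inE /= in_itv.
pose F (t : R) : R := - ln (f t); pose F' (t : R) : R := - (f' t / f t).
have dF (t : R) : 0 <= t <= 1 -> is_derive t (1 : R) F (F' t).
  move=> t01; apply: is_deriveN; rewrite mulrC.
  apply: (@is_derive1_comp _ (@ln R) f).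
    by apply: is_derive1_ln; exact: f0.
  by apply: f_derive; exact: Y0.
have cF (t : R) : 0 <= t <= 1 -> {for t, continuous F}.
  by move=> t01; apply: is_derive_cont (dF t t01).
have cf (t : R) : 0 <= t <= 1 -> {for t, continuous f}.
  by move=> t01; apply: is_derive_cont (f_derive (Y0 t t01)).
have dotc (u v : R -> 'I_d -> R) (t : R) : (forall i, {for t, continuous (u ^~ i)}) ->
    (forall i, {for t, continuous (v ^~ i)}) ->
    {for t, continuous (fun s => \sum_i u s i * v s i)}.
  by move=> cu cv; apply: cvg_sumr => i; apply: cvgM; [exact: cu|exact: cv].
have cF' (t : R) : 0 <= t <= 1 -> {for t, continuous F'}.
  move=> t01; apply: cvgN; apply: cvgM; last first.
    apply: cvgV; last exact: cf.
    by rewrite gt_eqF ?f0.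
  apply: cvgM; last by apply: cvgV; [exact: Y0|exact: Y_cont].
  apply: cvgB; last by apply: cvgM; [exact: cf|exact: Y'_cont].
  apply: cvgD.
    apply: (dotc (fun _ i => b 0 i) (fun s i => X' i s)) => i; first exact: cvg_cst.
    exact: X'_cont.
  apply: cvgM; first exact: cvg_cst.
  apply: cvgD; last by apply: cvgM; [exact: Y_cont|exact: Y'_cont].
  apply: (dotc (fun s i => X i s) (fun s i => X' i s)) => i; first exact: X_cont.
  exact: X'_cont.
have wF' : {within `[0, 1], continuous F'}.
  by apply: continuous_in_subspaceT => t /in01 /cF'.
have ws : {within `[0, 1], continuous (hyp_speed g)}.
  by apply: continuous_in_subspaceT => t /in01 /Y0; exact: hyp_speed_continuous.
have -> : ln (f 0) - ln (f 1) = \int[lebesgue_measure]_(t in `[0, 1]) F' t.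
  rewrite /Rintegral (@continuous_FTC2 _ F' F) //.
  - by rewrite /F -EFinB /= opprK addrC.
  - split.
    + move=> t; rewrite in_itv /= => /andP[t0 t1].
      by have [] := dF t; rewrite ?ltW.
    + by apply: cvg_at_right_filter; apply: cF; rewrite lexx ler01.
    + by apply: cvg_at_left_filter; apply: cF; rewrite lexx ler01.
  - move=> t; rewrite in_itv /= => /andP[t0 t1].
    have t01 : 0 <= t <= 1 by rewrite !ltW.
    by rewrite derive1E; have [_ ->] := dF t t01.
apply: le_Rintegral => //.
- by apply: continuous_compact_integrable => //; exact: segment_compact.
- by apply: continuous_compact_integrable => //; exact: segment_compact.
- move=> t /= ; rewrite in_itv /= => t01; rewrite /F' -mulNr ler_pdivrMr ?f0 //.
  apply: le_trans (f'_le _ _); rewrite ?gY ?f0 //.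
  by rewrite -normrN ler_norm.
Qed.

End Curves.

Section PlanarCurves.
Variables (R : realType) (d : nat) (x v : 'rV[R]_d) (s s' y y' : R -> R).
Hypothesis ds : forall t, is_derive t (1 : R) s (s' t).
Hypothesis dy : forall t, is_derive t (1 : R) y (y' t).

(** Curves in the vertical plane over a line; the geodesics are of this kind, and the speed depends
    on v only through its norm. *)
Definition planar_curve (t : R) : 'rV[R]_d * R := (x + s t *: v, y t).

Lemma is_derive_planar_curve (t : R) :
  is_derive t (1 : R) planar_curve (s' t *: v, y' t).
Proof.
have H : h^-1 *: (planar_curve (h *: (1 : R) + t) - planar_curve t)
    @[h --> 0^'] --> (s' t *: v, y' t).
  rewrite [X in X @ _](_ : _ = fun h : R =>
    (h^-1 *: (s (h *: (1 : R) + t) - s t) *: v,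
     h^-1 *: (y (h *: (1 : R) + t) - y t))); last first.
    apply/funext => h; congr (_, _).
    by rewrite /= opprD addrACA subrr add0r -scalerBl scalerA.
  apply: (@cvg_pair _ _ _ _ (nbhs (s' t *: v)) (nbhs (y' t))).
    apply: cvgZr_tmp; have [ex <-] := ds t; exact: ex.
  have [ex <-] := dy t; exact: ex.
apply: DeriveDef; first by apply: cvgP; exact: H.
by rewrite /derive; apply: cvg_lim => //; exact: H.
Qed.

Lemma derive1_planar_curve (t : R) :
  derive1 planar_curve t = (s' t *: v, y' t).
Proof. by rewrite derive1E; have [_ ->] := is_derive_planar_curve t. Qed.

Lemma hyp_speed_planar_curve (t : R) : hyp_speed planar_curve t =
  Num.sqrt (dot v v * s' t ^+ 2 + y' t ^+ 2) / y t.
Proof.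
rewrite /hyp_speed derive1_planar_curve /=; congr (Num.sqrt (_ + _) / _).
by rewrite mulr_suml; apply: eq_bigr => i _; rewrite mxE; ring.
Qed.

Lemma derive1_planar_curve_continuous : continuous s' -> continuous y' ->
  continuous (derive1 planar_curve).
Proof.
move=> cs cy; rewrite (_ : derive1 _ = fun t => (s' t *: v, y' t)).
  move=> t; apply: (@cvg_pair _ _ _ _ (nbhs (s' t *: v)) (nbhs (y' t))).
    by apply: cvgZr_tmp; exact: cs.
  exact: cy.
by apply/funext => t; rewrite derive1_planar_curve.
Qed.

End PlanarCurves.

(** * The distance as the inverse hyperbolic cosine of [coshd] *)

Section DistanceFormula.
Variables (R : realType) (d : nat).
Notation hyp := (hyp R d).
Implicit Types (p q r : hyp).

Lemma hyp_length_ge0 p q g : hyp_curve p q g -> 0 <= hyp_length g.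
Proof.
case=> _ _ gh _ _; apply: Rintegral_ge0 => t /=; rewrite in_itv /= => /gh gt.
by rewrite /hyp_speed divr_ge0 ?sqrtr_ge0 // ltW.
Qed.

(** The functional coshd(., q) - E^-1 coshd(., p) is lightlike: its discriminant is zero by the
    choice of E. Its value at p is E times that at q, so its logarithm drops by exactly l along any
    curve from p to q. *)
Lemma hyp_length_ge p q g l : 0 < l ->
  coshd p q = (expR l + (expR l)^-1) / 2 -> hyp_curve p q g ->
  l <= hyp_length g.
Proof.
move=> l0; set E := expR l => CE [dg cg gh g0 g1].
have E1 : 1 < E by rewrite expR_gt1.
have E0 : 0 < E by rewrite expR_gt0.
have En0 : E != 0 by rewrite gt_eqF.
have [[[a b] c] /= [fE nul]] := hlin_coshd2 1 (- E^-1) q p.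
have {}nul : dot b b = 4 * a * c.
  by apply/eqP; rewrite -subr_eq0 nul coshdC CE; apply/eqP; field.
have fq : hlin a b c q = (1 - E ^- 2) / 2.
  by rewrite -fE coshdxx coshdC CE; field.
have fp : hlin a b c p = E * hlin a b c q.
  by rewrite fq -fE coshdxx CE; field.
have fq0 : 0 < hlin a b c q.
  by rewrite fq divr_gt0 // subr_gt0 -exprVn expr_lt1 // ?invr_ge0 ?invf_lt1 // ltW.
have := @ln_null_le_length R d g dg cg a b c nul gh.
rewrite g0 g1 -[X in ln X - _]/(hlin a b c p) -[X in _ - ln X]/(hlin a b c q).
rewrite fp lnM ?posrE // addrK expRK; apply => t /gh gt.
exact: (@hlin_null_gt0 _ _ a b c q (@mkhyp _ _ (g t).1 _ gt) nul fq0).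
Qed.

(* The geodesic from p to q traversed at speed l: on the hyperboloid the
   coordinate [1 / height] is the combination of exp (l t) and exp (- l t)
   written U below, and [base] moves along the segment from p to q. *)
Lemma geodesic p q l : 0 < l ->
  coshd p q = (expR l + (expR l)^-1) / 2 ->
  exists2 g, hyp_curve p q g & hyp_length g = l.
Proof.
move=> l0; set E := expR l => CE.
have E1 : 1 < E by rewrite expR_gt1.
have E0 : 0 < E by rewrite expR_gt0.
have En0 : E != 0 by rewrite gt_eqF.
have yp0 := height_gt0 p; have yq0 := height_gt0 q.
set u := (height p)^-1; set w := (height q)^-1.
have u0 : 0 < u by rewrite invr_gt0.
have w0 : 0 < w by rewrite invr_gt0.
set v := base q - base p; set N := dot v v.
have NE : N * (u * w) ^+ 2 = u * w * (E + E^-1) - u ^+ 2 - w ^+ 2.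
  have -> : E + E^-1 = 2 * coshd p q by rewrite CE; field.
  rewrite /coshd /N /v /u /w !dotE (dotC (base q) (base p)); field.
  by rewrite !height_neq0.
set S := (E - E^-1) / 2.
have S0 : 0 < S by rewrite divr_gt0 // subr_gt0 (lt_trans _ E1) // invf_lt1.
have Sn0 : S != 0 by rewrite gt_eqF.
(* The solution of [U 0 = u * S] and [U 1 = w * S] with S = sinh l, so that the height S / U takes
   the right values at both ends. *)
set A := (w - u / E) / 2; set D := (u * E - w) / 2.
(* With [ADS] this shows that A and D are non-negative, hence U positive; it is also the identity
   that makes the speed constant. *)
have AD : 4 * A * D = N * (u * w) ^+ 2.
  by rewrite NE /A /D; field.
have ADS : A + D = u * S by rewrite /A /D /S; field.
have AD0 : 0 <= A * D.
  have : 0 <= N * (u * w) ^+ 2 by rewrite mulr_ge0 ?sqr_ge0 ?dot_ge0.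
  by rewrite -AD -mulrA pmulr_rge0.
have uS0 : 0 < u * S by rewrite mulr_gt0.
have A0 : 0 <= A by nra.
have D0 : 0 <= D by nra.
pose z t := expR (l * t); pose zi t := (z t)^-1.
have z0 t : 0 < z t by rewrite expR_gt0.
have zn0 t : z t != 0 by rewrite gt_eqF.
pose U t := A * z t + D * zi t; pose b t := (z t - zi t) / 2.
have U0 t : 0 < U t.
  have zi0 : 0 < zi t by rewrite invr_gt0.
  rewrite /U; have [A1|A1] := eqVneq A 0.
    have D1 : 0 < D by move: ADS; rewrite A1 add0r => ->.
    by rewrite A1 mul0r add0r mulr_gt0.
  apply: ltr_pwDl; last by rewrite mulr_ge0 // ltW.
  by rewrite mulr_gt0 // lt_def A1.
have Un0 t : U t != 0 by rewrite gt_eqF.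
have dz (t : R) : is_derive t (1 : R) z (l * z t).
  have dl : is_derive t (1 : R) (fun x : R => l * x) l.
    by have := is_deriveZ l (is_derive_id t (1 : R)); rewrite /GRing.scale /= mulr1.
  have := is_derive1_comp (is_derive_expR (l * t)) dl.
  by rewrite [_ * l]mulrC.
have dzi (t : R) : is_derive t (1 : R) zi (- (l * zi t)).
  apply: (is_derive_eq (is_deriveV (zn0 t) (dz t))).
  by rewrite /zi /GRing.scale /=; field.
pose U' t := l * (A * z t - D * zi t); pose b' t := l * (z t + zi t) / 2.
have dU (t : R) : is_derive t (1 : R) U (U' t).
  apply: (is_derive_eq (is_deriveD (is_deriveZ A (dz t)) (is_deriveZ D (dzi t)))).
  by rewrite /U' /GRing.scale /=; ring.
have db (t : R) : is_derive t (1 : R) b (b' t).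
  have -> : b = 2^-1 \*: (z - zi) by apply/funext => s; rewrite /b /GRing.scale /= mulrC.
  apply: (is_derive_eq (is_deriveZ (2^-1) (is_deriveB (dz t) (dzi t)))).
  by rewrite /b' /GRing.scale /=; field.
pose y t := S / U t; pose y' t := - S * U' t / U t ^+ 2.
pose s t := w * b t / U t; pose s' t := l * w * u * S / U t ^+ 2.
have dUV (t : R) := is_deriveV (Un0 t) (dU t).
have dy (t : R) : is_derive t (1 : R) y (y' t).
  apply: (is_derive_eq (is_deriveZ S (dUV t))).
  by rewrite /y' /GRing.scale /=; field.
have zziE t : z t * zi t = 1 by rewrite mulfV.
have ds (t : R) : is_derive t (1 : R) s (s' t).
  apply: (is_derive_eq (is_deriveM (is_deriveZ w (db t)) (dUV t))).
  rewrite /GRing.scale /=.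
  transitivity (w * (b' t * U t - b t * U' t) / U t ^+ 2).
    by rewrite /GRing.scale /=; field.
  rewrite /s'; congr (_ / _).
  transitivity (w * (l * (z t * zi t) * (A + D))).
    by rewrite /b' /b /U' /U; field.
  by rewrite zziE ADS; ring.
have cz : continuous z.
  by move=> t; apply/differentiable_continuous/derivable1_diffP; case: (dz t).
have czi : continuous zi by move=> t; apply: cvgV => //; exact: cz.
have cU : continuous U.
  move=> t; apply: cvgD; (apply: cvgM; first exact: cvg_cst); first exact: cz.
  exact: czi.
have cU' : continuous U'.
  move=> t; apply: cvgM; first exact: cvg_cst.
  apply: cvgB; (apply: cvgM; first exact: cvg_cst); first exact: cz.
  exact: czi.
have cU2 : continuous (fun t => (U t ^+ 2)^-1).
  move=> t; apply: cvgV; first by rewrite expf_neq0.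
  by apply: cvgM; exact: cU.
have cs' : continuous s'.
  by move=> t; apply: cvgM; [exact: cvg_cst|exact: cU2].
have cy' : continuous y'.
  move=> t; apply: cvgM; last exact: cU2.
  by apply: cvgM; [exact: cvg_cst|exact: cU'].
have z_0 : z 0 = 1 by rewrite /z mulr0 expR0.
have z_1 : z 1 = E by rewrite /z mulr1.
exists (planar_curve (base p) v s y).
  split.
  - by move=> t; have [] := is_derive_planar_curve (base p) v ds dy t.
  - exact: derive1_planar_curve_continuous ds dy cs' cy'.
  - by move=> t _; rewrite /half_space /= /y divr_gt0.
  - rewrite /planar_curve (_ : s 0 = 0); last first.
      by rewrite /s /b /zi z_0 invr1 subrr mul0r mulr0 mul0r.
    rewrite scale0r addr0 (_ : y 0 = height p) -?surjective_pairing //.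
    rewrite /y /U /zi z_0 invr1 !mulr1 ADS /u.
    by field; rewrite Sn0 height_neq0.
  - have U1 : U 1 = w * S by rewrite /U /zi z_1 /A /D /S; field.
    rewrite /planar_curve (_ : s 1 = 1); last first.
      by rewrite /s U1 /b /zi z_1 -/S; field; rewrite Sn0 gt_eqF.
    rewrite scale1r /v addrC subrK (_ : y 1 = height q) -?surjective_pairing //.
    by rewrite /y U1 /w; field; rewrite Sn0 height_neq0.
have sp t : hyp_speed (planar_curve (base p) v s y) t = l.
  rewrite (hyp_speed_planar_curve (base p) v ds dy) -/N.
  have -> : N * s' t ^+ 2 + y' t ^+ 2 = (l * y t) ^+ 2.
    transitivity ((l * S) ^+ 2 * (N * (u * w) ^+ 2 + (A * z t - D * zi t) ^+ 2) / U t ^+ 4).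
      by rewrite /s' /y' /U'; field.
    rewrite -AD.
    have -> : 4 * A * D + (A * z t - D * zi t) ^+ 2 = U t ^+ 2.
      transitivity (4 * A * D * (z t * zi t) + (A * z t - D * zi t) ^+ 2).
        by rewrite zziE mulr1.
      by rewrite /U; ring.
    by rewrite /y; field.
  have y0 : 0 < y t by rewrite divr_gt0.
  have ly0 : 0 < l * y t by exact: mulr_gt0.
  by rewrite sqrtr_sqr (gtr0_norm ly0) -mulrA mulfV ?mulr1 // gt_eqF.
rewrite /hyp_length (_ : hyp_speed _ = cst l); last exact/funext.
rewrite Rintegral_cst // -[RHS]mulr1; congr (_ * _).
transitivity (fine (@lebesgue_measure R `[0%R, 1%R]%classic)); first by [].
by rewrite lebesgue_measure_itv /= lte_fin ltr01 sube0.
Qed.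

Lemma hyp_curve_cst p : hyp_curve p p (cst (set_val p)).
Proof.
split=> // [t|t _]; last exact: height_gt0.
rewrite (_ : derive1 _ = cst 0); first exact: cvg_cst.
by apply/funext => s; rewrite derive1_cst.
Qed.

Lemma hyp_distE p q l : 0 <= l ->
  coshd p q = (expR l + (expR l)^-1) / 2 -> hyp_dist p q = l.
Proof.
rewrite le_eqVlt => /orP[/eqP<-|l0] C.
  (* For l = 0 the points coincide, and the constant curve attains the infimum. *)
  have <- : p = q.
    by apply: coshd_eq1; rewrite C expR0 invr1; field.
  have l0 : hyp_length (cst (set_val p) : R -> 'rV[R]_d * R) = 0.
    rewrite /hyp_length (_ : hyp_speed _ = cst 0); first by rewrite Rintegral_cst // mul0r.
    apply/funext => t; rewrite /hyp_speed derive1_cst /= big1 => [|i _].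
      by rewrite expr0n addr0 sqrtr0 mul0r.
    by rewrite mxE expr0n.
  have lb : lbound [set hyp_length g | g in hyp_curve p p] 0.
    by move=> _ [g gc <-]; exact: hyp_length_ge0 gc.
  have pp : [set hyp_length g | g in hyp_curve p p] 0.
    by exists (cst (set_val p)) => //; exact: hyp_curve_cst.
  apply/eqP; rewrite eq_le lb_le_inf ?andbT; [|by exists 0|by []].
  by apply: ge_inf => //; exists 0.
have [g gc gl] := geodesic l0 C.
have lb : lbound [set hyp_length g | g in hyp_curve p q] l.
  by move=> _ [h hc <-]; exact: hyp_length_ge l0 C hc.
apply/eqP; rewrite eq_le lb_le_inf ?andbT; [|by exists l, g|by []].
by apply: ge_inf; [exists l|exists g].
Qed.

Lemma coshd_expR p q : exists2 l, 0 <= l &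
  coshd p q = (expR l + (expR l)^-1) / 2.
Proof.
set C := coshd p q; have C1 : 1 <= C by exact: coshd_ge1.
set s := Num.sqrt (C ^+ 2 - 1).
have s2 : s ^+ 2 = C ^+ 2 - 1 by rewrite sqr_sqrtr // subr_ge0; nra.
have s0 : 0 <= s by rewrite sqrtr_ge0.
have Cs : 1 <= C + s by lra.
have Cs0 : 0 < C + s by rewrite (lt_le_trans ltr01).
exists (ln (C + s)); first by rewrite ln_ge0.
rewrite lnK ?posrE // (_ : (C + s)^-1 = C - s); first by field.
apply: (mulfI (lt0r_neq0 Cs0)); rewrite mulfV ?lt0r_neq0 //.
transitivity (C ^+ 2 - s ^+ 2); last by ring.
by rewrite s2; ring.
Qed.

Lemma hyp_dist_coshd p q p' q' :
  hyp_dist p q = hyp_dist p' q' <-> coshd p q = coshd p' q'.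
Proof.
have [l l0 C] := coshd_expR p q; have [l' l'0 C'] := coshd_expR p' q'.
have dE := hyp_distE l0 C; have dE' := hyp_distE l'0 C'.
split=> [|CC]; first by rewrite dE dE' C C' => ->.
by rewrite dE; apply/esym/hyp_distE; rewrite // -CC.
Qed.

End DistanceFormula.

(** * Isometries *)

Section Isometries.
Variables (R : realType) (d : nat).
Notation hyp := (hyp R d).
Implicit Types (p q r : hyp) (f g h : hyp -> hyp).

Lemma hyp_isometryP f : hyp_isometry f <->
  bijective f /\ forall p q, coshd (f p) (f q) = coshd p q.
Proof.
by split=> -[bf fE]; split=> // p q; apply/hyp_dist_coshd; apply: fE.
Qed.

Lemma isometry_coshd f p q : hyp_isometry f -> coshd (f p) (f q) = coshd p q.
Proof. by move=> /hyp_isometryP[_]. Qed.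

Lemma isometry_comp f g :
  hyp_isometry f -> hyp_isometry g -> hyp_isometry (f \o g).
Proof.
move=> [bf fE] [bg gE]; split; first exact: bij_comp.
by move=> p q; rewrite /= fE gE.
Qed.

Lemma isometry_inv f : hyp_isometry f ->
  exists g, [/\ cancel f g, cancel g f & hyp_isometry g].
Proof.
move=> [[g fK gK] fE]; exists g; split=> //; split; first by exists f.
by move=> p q; rewrite -fE !gK.
Qed.

Definition is_hlin (F : hyp -> R) := exists a b c, forall p, F p = hlin a b c p.

Lemma is_hlinD F G : is_hlin F -> is_hlin G -> is_hlin (fun p => F p + G p).
Proof.
move=> [a [b [c FE]]] [a' [b' [c' GE]]]; exists (a + a'), (b + b'), (c + c').
by move=> p; rewrite FE GE /hlin !dotE; ring.
Qed.

Lemma is_hlinZ k F : is_hlin F -> is_hlin (fun p => k * F p).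
Proof.
move=> [a [b [c FE]]]; exists (k * a), (k *: b), (k * c).
by move=> p; rewrite FE /hlin !dotE; ring.
Qed.

Lemma is_hlin_coshd q : is_hlin (fun p => coshd p q).
Proof. by eexists; eexists; eexists => p; exact: coshd_hlin. Qed.

Lemma is_hlin_sum (F : 'I_d -> hyp -> R) : (forall i, is_hlin (F i)) ->
  is_hlin (fun p => \sum_i F i p).
Proof.
move=> Fl; elim: (index_enum _) => [|i s IH].
  exists 0, 0, 0 => p; rewrite big_nil /hlin dot0l; ring.
have [a [b [c E]]] := is_hlinD (Fl i) IH.
by exists a, b, c => p; rewrite big_cons E.
Qed.

(** Points whose functions [coshd ^~ q] are enough to express [1 / height] and all x_i / height
    linearly. *)
Let q1 : hyp := mkhyp 0 (ltr01 : 0 < 1 :> R).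
Let q2 : hyp := mkhyp 0 (ltr0n R 2 : 0 < 2 :> R).
Let qe (i : 'I_d) : hyp := mkhyp (delta_mx 0 i) (ltr01 : 0 < 1 :> R).

Let hlin_height p : (height p)^-1 = 3^-1 * 4 * coshd p q2 - 3^-1 * 2 * coshd p q1.
Proof.
rewrite /coshd !base_mkhyp !height_mkhyp !dotE; field; exact: height_neq0.
Qed.

Let hlin_entry i p :
  base p 0 i / height p = coshd p q1 - coshd p (qe i) + 2^-1 * (height p)^-1.
Proof.
rewrite /coshd !base_mkhyp !height_mkhyp !dotE !dot_deltal !dot_deltar mxE !eqxx /=.
field; exact: height_neq0.
Qed.

(** The function [1 / height] is a lightlike combination of the [coshd] to two points. Composing
    with f replaces these points by their preimages, which have the same mutual [coshd], so the
    discriminant stays zero. *)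
Lemma isometry_height f : hyp_isometry f -> exists abc : R * 'rV[R]_d * R,
  dot abc.1.2 abc.1.2 = 4 * abc.1.1 * abc.2 /\
  forall p, (height (f p))^-1 = hlin abc.1.1 abc.1.2 abc.2 p.
Proof.
move=> fi; have [g [fK gK gi]] := isometry_inv fi.
have [abc [abcE nul]] := hlin_coshd2 (3^-1 * 4) (- (3^-1 * 2)) (g q2) (g q1).
exists abc; split.
  apply/eqP; rewrite -subr_eq0 nul (isometry_coshd _ _ gi).
  by rewrite /coshd !base_mkhyp !height_mkhyp !dotE; apply/eqP; field.
move=> p; rewrite -abcE hlin_height -(isometry_coshd p _ fi) gK.
by rewrite -(isometry_coshd p (g q1) fi) gK; ring.
Qed.

(** This is the linear action on the hyperboloid: [coshd (f p) q] is [coshd p (g q)] for the inverse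
    g of f, and every [hlin] is a combination of functions of this form. *)
Lemma isometry_hlin f a b c : hyp_isometry f -> is_hlin (hlin a b c \o f).
Proof.
move=> fi; have [g [fK gK gi]] := isometry_inv fi.
have coshf q : is_hlin (fun p => coshd (f p) q).
  have [a' [b' [c' E]]] := is_hlin_coshd (g q); exists a', b', c' => p.
  by rewrite -E -(isometry_coshd p _ fi) gK.
have hf : is_hlin (fun p => (height (f p))^-1).
  have [a' [b' [c' E]]] := is_hlinD (is_hlinZ (3^-1 * 4) (coshf q2))
    (is_hlinZ (- (3^-1 * 2)) (coshf q1)).
  by exists a', b', c' => p; rewrite -E hlin_height; ring.
have ef i : is_hlin (fun p => base (f p) 0 i / height (f p)).
  have [a' [b' [c' E]]] := is_hlinD (coshf q1) (is_hlinD (is_hlinZ (- 1)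
    (coshf (qe i))) (is_hlinZ 2^-1 hf)).
  by exists a', b', c' => p; rewrite -E hlin_entry; ring.
(* Twice [coshd p q1] is (dot x x + y^2 + 1) / y; multiplied by c it leaves a - c as the coefficient
   of 1 / y. *)
have [a' [b' [c' E]]] := is_hlinD (is_hlinZ (a - c) hf) (is_hlinD
  (is_hlin_sum (fun i => is_hlinZ (b 0 i) (ef i))) (is_hlinZ (2 * c) (coshf q1))).
exists a', b', c' => p; rewrite -E /= /hlin /coshd base_mkhyp height_mkhyp !dotE.
have -> : \sum_i b 0 i * (base (f p) 0 i / height (f p)) = dot b (base (f p)) / height (f p).
  by rewrite mulr_suml; apply: eq_bigr => i _; rewrite mulrA.
field; exact: height_neq0.
Qed.

Lemma coshd_nbhs (c : hyp) (e : R) : 0 < e -> exists2 n : R, 0 < n &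
  forall q, coshd q c < 1 + n ->
    (forall i, `|base q 0 i - base c 0 i| < e) /\ `|height q - height c| < e.
Proof.
move=> e0; have y0 := height_gt0 c.
(* The hypothesis bounds the squared Euclidean distance by 2 m times the product of the heights. The
   bound 1/4 on m gives height q <= 5/2 height c, so the distance squared is below 5 m (height c)^2,
   which is at most e^2. *)
set m := Num.min (4^-1) (e ^+ 2 / (5 * height c ^+ 2)).
have y20 : 0 < 5 * height c ^+ 2 by rewrite mulr_gt0 ?exprn_gt0.
have m0 : 0 < m by rewrite lt_min invr_gt0 ltr0n divr_gt0 ?exprn_gt0.
exists m => // q; have z0 := height_gt0 q.
rewrite /coshd ltr_pdivrMr ?mulr_gt0 // => H.
have m4 : m <= 4^-1 by rewrite ge_min lexx.
have me : 5 * m * height c ^+ 2 <= e ^+ 2.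
  rewrite -mulrA mulrCA -ler_pdivlMr //.
  by rewrite ge_min lexx orbT.
have D0 := dot_ge0 (base q - base c).
have yz : m * (height q * height c) <= 4^-1 * (height q * height c).
  by rewrite ler_wpM2r // mulr_ge0 // ltW.
have zy : height q <= 5 / 2 * height c by nra.
have yz' : m * (height q * height c) <= m * (5 / 2 * height c * height c).
  by rewrite ler_wpM2l ?(ltW m0) // ler_wpM2r // ltW.
have B : dot (base q - base c) (base q - base c) + (height q - height c) ^+ 2 < e ^+ 2.
  by nra.
have sq (x : R) : x ^+ 2 < e ^+ 2 -> `|x| < e.
  by rewrite -(real_normK (num_real x)) ltr_pXn2r ?nnegrE // ltW.
split=> [i|]; apply: sq.
  have := dot_entry (base q - base c) i; rewrite !mxE => E.
  by have := sqr_ge0 (height q - height c); lra.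
by lra.
Qed.

End Isometries.

(** * Continuity of [coshd] and hyperbolic balls *)

Section CoshdBalls.
Variables (R : realType) (d : nat).
Notation hyp := (hyp R d).
Implicit Types (p q r : hyp) (f g h : hyp -> hyp) (A : set hyp).

Lemma set_val_continuous : continuous (@set_val _ (@half_space R d) : hyp -> _).
Proof. exact: initial_continuous. Qed.

Lemma height_continuous : continuous (@height R d).
Proof.
move=> p; apply: (@continuous_comp _ _ _ _ snd); first exact: set_val_continuous.
exact: cvg_snd.
Qed.

Lemma base_entry_continuous i : continuous (fun p : hyp => base p 0 i).
Proof.
move=> p; apply: (@continuous_comp _ _ _ (fun q : hyp => base q) (fun M : 'rV[R]_d => M 0 i)).
  apply: (@continuous_comp _ _ _ _ fst); first exact: set_val_continuous.
  exact: cvg_fst.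
exact: coord_continuous.
Qed.

(* Over an abstract space, because continuity lemmas applied to [hyp] directly
   unfold its initial topology. *)
Let coshd_formula_continuous (T : topologicalType) (p : T)
    (X : T -> 'rV[R]_d) (Y : T -> R) (a : 'rV[R]_d) (b : R) :
  (forall i, {for p, continuous (fun t => X t 0 i)}) -> {for p, continuous Y} ->
  Y p != 0 -> b != 0 -> {for p, continuous (fun t =>
    (dot (X t - a) (X t - a) + Y t ^+ 2 + b ^+ 2) / (2 * Y t * b))}.
Proof.
move=> cX cY Y0 b0; apply: cvgM.
  apply: cvgD; last exact: cvg_cst.
  apply: cvgD; last by apply: cvgM; exact: cY.
  apply: cvg_sumr => i; rewrite (_ : (fun t => _) =
      fun t => (X t 0 i - a 0 i) * (X t 0 i - a 0 i)); last first.
    by apply/funext => t; rewrite !mxE.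
  rewrite !mxE; apply: cvgM; (apply: cvgB; last exact: cvg_cst); exact: cX.
apply: cvgV; first by rewrite !mulf_neq0.
apply: cvgM; last exact: cvg_cst.
by apply: cvgM; [exact: cvg_cst|exact: cY].
Qed.

Lemma coshd_continuous q : continuous (fun p => coshd p q).
Proof.
move=> p; apply: (@coshd_formula_continuous _ p (@base R d) (@height R d));
  try exact: height_neq0.
- by move=> i; exact: base_entry_continuous.
- exact: height_continuous.
Qed.

(** The open hyperbolic ball of radius arcosh (1 + n), for n > 0. *)
Definition cball p n : set hyp := [set q | coshd q p < 1 + n].

Lemma cball_interior p q n A : cball p n q -> cball p n `<=` A -> A° q.
Proof.
move=> pq nA; rewrite /interior /=; apply: filterS nA _.
apply: (@coshd_continuous p q [set x | x < 1 + n]).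
exact: lt_nbhsl.
Qed.

Lemma cball_image f p n A : hyp_isometry f ->
  cball p n `<=` A -> cball (f p) n `<=` f @` A.
Proof.
move=> fi nA q; have [g [fK gK gi]] := isometry_inv fi.
rewrite /cball /= -(isometry_coshd q _ gi) fK => qp.
by exists (g q); [exact: nA|exact: gK].
Qed.

Lemma tiling_overlap (T : set (set hyp)) t t' p p' q n n' : tiling T ->
  T t -> T t' -> cball p n q -> cball p' n' q ->
  cball p n `<=` t -> cball p' n' `<=` t' -> t = t'.
Proof.
move=> [_ _ dT] Tt Tt' nq nq' nt nt'; apply: contrapT => tt'.
have H : (t° `&` t'°) q.
  by split; [exact: cball_interior nq nt|exact: cball_interior nq' nt'].
by rewrite dT in H.
Qed.

End CoshdBalls.

Section Prototile.
Variables (R : realType) (d : nat).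
Notation hyp := (hyp R d).
Implicit Types (p q r : hyp) (f g h : hyp -> hyp).
Implicit Types (x : 'rV[R]_d) (sg : 'I_d -> bool).

Lemma cubeP x : cube x <-> forall i, `|x 0 i| <= 2^-1.
Proof. by split=> cx i; have := cx i; rewrite !mxE ler_norml. Qed.

Lemma prototileP p : prototile p <->
  (forall i, `|base p 0 i| <= 2^-1) /\ 2^-1 <= height p <= 1.
Proof.
split=> [[/cubeP cb]|[/cubeP cb hb]]; first by rewrite /= in_itv /= => hb; split.
by split=> //=; rewrite in_itv.
Qed.

Lemma prototile_closed p : ~ prototile p ->
  exists2 n, 0 < n & forall q, cball p n q -> ~ prototile q.
Proof.
move=> /prototileP np.
have [e e0 ep] : exists2 e, 0 < e & forall q : hyp,
    (forall i, `|base q 0 i - base p 0 i| < e) /\ `|height q - height p| < e ->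
    ~ prototile q.
  have [[i]|bp] := pselect (exists i, 2^-1 < `|base p 0 i|).
    rewrite -subr_gt0 => pi; exists (`|base p 0 i| - 2^-1) => // q [/(_ i) qp _].
    move=> /prototileP[/(_ i) qi _].
    have := ler_distD 0 (base p 0 i) (base q 0 i).
    have := ler_normB (base q 0 i) (base q 0 i - base p 0 i).
    by rewrite opprB addrC subrK; lra.
  have bp' i : `|base p 0 i| <= 2^-1.
    by rewrite leNgt; apply/negP => ?; apply: bp; exists i.
  have {np}/negP : ~ (2^-1 <= height p <= 1) by move=> ?; apply: np.
  rewrite negb_and -!ltNge => /orP[hp|hp].
    exists (2^-1 - height p); first by rewrite subr_gt0.
    move=> q [_ +] /prototileP[_ /andP[+ _]].
    by rewrite ltr_norml => /andP[]; lra.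
  exists (height p - 1); first by rewrite subr_gt0.
  move=> q [_ +] /prototileP[_ /andP[_ +]].
  by rewrite ltr_norml => /andP[]; lra.
have [n n0 np'] := coshd_nbhs p e0.
by exists n => // q /np'; exact: ep.
Qed.

Lemma tile_closed f p : hyp_isometry f -> ~ (f @` @prototile R d) p ->
  exists2 n, 0 < n & forall q, cball p n q -> ~ (f @` @prototile R d) q.
Proof.
move=> fi; have [g [fK gK gi]] := isometry_inv fi => np.
have /prototile_closed[n n0 H] : ~ prototile (g p).
  by move=> gp; apply: np; exists (g p).
exists n => // q qp [r Br rq]; apply: (H r) Br.
by rewrite /cball /= -rq in qp *; rewrite -(isometry_coshd _ _ fi) gK.
Qed.

Lemma cball_center (x0 : 'rV[R]_d) (y0 : R) (h0 : 0 < y0) :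
  exists2 n, 0 < n & forall q, cball (mkhyp x0 h0) n q ->
    (forall i, `|base q 0 i - x0 0 i| < 4^-1) /\ `|height q - y0| < 4^-1.
Proof.
have e0 : 0 < 4^-1 :> R by rewrite invr_gt0.
have [n n0 H] := coshd_nbhs (mkhyp x0 h0) e0.
by exists n => // q /H.
Qed.

End Prototile.

(** * Symmetries of the prototile *)

Section HorosphericalIsometries.
Variables (R : realType) (d : nat).
Notation hyp := (hyp R d).
Implicit Types (p q r : hyp) (f g h : hyp -> hyp) (x : 'rV[R]_d).

(** With the heights known, invariance of [coshd] determines the Euclidean distances of the bases.
    Points on one vertical line are at base distance 0, so their images are on one vertical line too
    and [phi] is well defined. *)
Lemma isometry_scaling f (k : R) : hyp_isometry f -> 0 < k ->
  (forall p, height (f p) = k * height p) ->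
  exists phi : 'rV[R]_d -> 'rV[R]_d, (forall p, base (f p) = phi (base p)) /\
    forall x y, dot (phi x - phi y) (phi x - phi y) = k ^+ 2 * dot (x - y) (x - y).
Proof.
move=> fi k0 fh.
have fb p q : dot (base (f p) - base (f q)) (base (f p) - base (f q)) =
    k ^+ 2 * dot (base p - base q) (base p - base q).
  have := isometry_coshd p q fi; rewrite /coshd !fh => H.
  have pz := height_neq0 p; have qz := height_neq0 q.
  have kz : k != 0 by rewrite gt_eqF.
  have /(congr1 (fun z => z * (2 * (k * height p) * (k * height q)))) := H.
  rewrite divfK; last by rewrite !mulf_neq0.
  have -> : (dot (base p - base q) (base p - base q) + height p ^+ 2 + height q ^+ 2) /
    (2 * height p * height q) * (2 * (k * height p) * (k * height q)) =
    k ^+ 2 * (dot (base p - base q) (base p - base q) + height p ^+ 2 + height q ^+ 2).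
    by field; rewrite pz qz.
  by move=> E; apply: (addIr ((k * height p) ^+ 2 + (k * height q) ^+ 2));
    rewrite addrA E; ring.
pose m x : hyp := mkhyp x (ltr01 : 0 < 1 :> R).
exists (fun x => base (f (m x))); split=> [p|x y]; last by rewrite fb.
apply/eqP; rewrite -subr_eq0; apply/eqP/dot_eq0.
by rewrite fb base_mkhyp subrr dot0l mulr0.
Qed.

(** For e > 0 this corner of the cube of half-side e maximizes [dot b]; a negative e gives the
    minimizing one. *)
Lemma sum_sgr_norm (b : 'rV[R]_d) (e : R) :
  dot b (\row_i (e * (-1) ^+ (b 0 i < 0)%R)) = e * \sum_i `|b 0 i|.
Proof.
rewrite mulr_sumr; apply: eq_bigr => i _; rewrite mxE mulrCA; congr (_ * _).
have [b0|b0] := ltrP (b 0 i) 0; first by rewrite expr1 mulrN1 ltr0_norm.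
by rewrite expr0 mulr1 ger0_norm.
Qed.

Lemma corner_norm (b : 'rV[R]_d) (e : R) i :
  `|(\row_j (e * (-1) ^+ (b 0 j < 0)%R)) 0 i| = `|e|.
Proof. by rewrite mxE normrM normrX normrN1 expr1n mulr1. Qed.

Lemma dot_corner (b : 'rV[R]_d) (e : R) (v := \row_j (e * (-1) ^+ (b 0 j < 0)%R)) :
  dot v v = e ^+ 2 *+ d.
Proof.
rewrite -[d in RHS]card_ord -sumr_const; apply: eq_bigr => i _.
by rewrite -expr2 -[LHS]ger0_norm ?sqr_ge0 // normrX corner_norm -normrX
  ger0_norm ?sqr_ge0.
Qed.

Lemma sumsq_le_sqsum (b : 'rV[R]_d) : dot b b <= (\sum_i `|b 0 i|) ^+ 2.
Proof.
rewrite expr2 mulr_suml; apply: ler_sum => i _.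
rewrite -expr2 -(real_normK (num_real (b 0 i))) expr2 ler_wpM2l //.
by rewrite (bigD1 i) //= lerDl sumr_ge0.
Qed.

End HorosphericalIsometries.

Section PrototileSymmetries.
Variables (R : realType) (d : nat).
Hypothesis d0 : (0 < d)%N.
Notation hyp := (hyp R d).
Implicit Types (p q r : hyp) (f g h : hyp -> hyp) (x : 'rV[R]_d).

Lemma prototile_corner (b : 'rV[R]_d) (y : R) (y0 : 0 < y) : 2^-1 <= y <= 1 ->
  prototile (mkhyp (\row_j (2^-1 * (-1) ^+ (b 0 j < 0)%R)) y0).
Proof.
move=> yb; apply/prototileP; split=> // i.
by rewrite base_mkhyp corner_norm ger0_norm ?invr_ge0.
Qed.

Lemma prototile_axis (y : R) (y0 : 0 < y) : 2^-1 <= y <= 1 ->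
  prototile (mkhyp (0 : 'rV[R]_d) y0).
Proof.
by move=> yb; apply/prototileP; split=> // i; rewrite base_mkhyp mxE normr0 invr_ge0.
Qed.

(* A symmetry carries the horofunction [1 / height] to a horofunction
   [hlin a b c] with values in [1, 2] on the prototile; the values at the two
   points of the axis and at the corners maximizing [dot b] force [c = 0]. *)
Lemma prototile_symmetry_height h : hyp_isometry h ->
  h @` @prototile R d `<=` @prototile R d -> forall p, height (h p) = height p.
Proof.
move=> hi hB; have [[[a b] c] /= [nul hE]] := isometry_height hi.
have half0 : 0 < 2^-1 :> R by rewrite invr_gt0.
have bd p : prototile p -> 1 <= hlin a b c p <= 2.
  move=> Bp; have /prototileP[_ /andP[h1 h2]] : prototile (h p).
    by apply: hB; exists p.
  rewrite -hE; have := height_gt0 (h p) => h0; apply/andP; split.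
    by rewrite invf_ge1.
  by rewrite -[2]invrK lef_pV2 ?posrE.
have hh1 : 2^-1 <= (2^-1 : R) <= 1 by rewrite lexx /=; lra.
have h11 : 2^-1 <= (1 : R) <= 1 by rewrite lexx andbT; lra.
have /andP[_ t1] := bd _ (prototile_corner b half0 hh1).
have /andP[_ t2] := bd _ (prototile_corner b ltr01 h11).
have /andP[t3 t3'] := bd _ (prototile_axis half0 hh1).
have /andP[t4 _] := bd _ (prototile_axis ltr01 h11).
move: t1 t2 t3 t3' t4.
rewrite /hlin !base_mkhyp !height_mkhyp !dot0r sum_sgr_norm dot_corner.
have s0 : 0 <= \sum_i `|b 0 i| by apply: sumr_ge0.
have N0 := dot_ge0 b; have Ns := sumsq_le_sqsum b.
move: s0 N0 Ns nul; set s := \sum_i _; set N := dot b b => s0 N0 Ns nul.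
rewrite invr1 !invrK -[_ *+ d]mulr_natr.
have : (1 : R) <= d%:R by rewrite ler1n.
move: (d%:R : R) => D D1 t1 t2 t3 t3' t4.
(* A negative c would force a > 1 and a * c < 0, against 4 a c = N >= 0. A positive c would give 4 a
   <= s <= c, which is incompatible with the bounds at the four points. *)
have c0 : c = 0.
  apply/eqP; apply: contraT => cn0.
  have cp : 0 < c.
    rewrite lt_def cn0 /= leNgt; apply/negP => cneg.
    have a1 : 1 < a by lra.
    have : a * c < 0 by rewrite pmulr_rlt0 // (lt_trans ltr01).
    lra.
  have cD : 0 <= c * (D - 1) by rewrite mulr_ge0 ?subr_ge0 // ltW.
  have ap : 0 <= a by rewrite -(pmulr_lge0 _ cp); lra.
  have e1 : s <= c by lra.
  have e2 : 4 * a <= s.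
    have sc : s ^+ 2 <= s * c by rewrite expr2 ler_wpM2l.
    by rewrite -(ler_pM2r cp); lra.
  lra.
have b0 : b = 0 by apply: dot_eq0; rewrite -/N nul c0 mulr0.
have a1 : a = 1 by rewrite c0 in t3' t4; lra.
by move=> p; apply: invr_inj; rewrite hE /hlin a1 b0 c0 dot0l; ring.
Qed.

End PrototileSymmetries.

Section SignedPermutations.
Variables (R : realType) (d : nat).
Hypothesis d0 : (0 < d)%N.
Notation hyp := (hyp R d).
Implicit Types (p q r : hyp) (f g h : hyp -> hyp) (x : 'rV[R]_d).

Definition signed_entries (phi : 'rV[R]_d -> 'rV[R]_d) := forall i,
  exists j e, `|e| = 1 /\ forall x, phi x 0 i = e * x 0 j.

(* The i-th entry of phi is [dot ^~ f] with f of Euclidean norm 1, and of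
   l1-norm at most 1 since phi preserves the cube; so f is a signed unit
   vector. *)
Lemma cube_isometry_signed (phi : 'rV[R]_d -> 'rV[R]_d) :
  (forall x y, dot (phi x - phi y) (phi x - phi y) = dot (x - y) (x - y)) ->
  (forall x, cube x -> cube (phi x)) ->
  (forall x, exists2 y, phi y = x & cube x -> cube y) ->
  phi 0 = 0 /\ signed_entries phi.
Proof.
move=> phiE phiC phiS.
have phi0 : phi 0 = 0.
  (* Here v is a corner with signs opposite to a. Its preimage w lies in the cube, so w is no longer
     than v, while the squared length of w, equal to that of a - v, is that of v plus two
     non-negative terms in a. *)
  set a := phi 0; set v : 'rV[R]_d := \row_j (- 2^-1 * (-1) ^+ (a 0 j < 0)%R).
  have cv : cube v.
    by apply/cubeP => i; rewrite corner_norm normrN ger0_norm ?invr_ge0.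
  have [w wv /(_ cv) /cubeP cw] := phiS v.
  have vv : dot v v = 2^-1 ^+ 2 *+ d by rewrite dot_corner sqrrN.
  have ww : dot w w <= 2^-1 ^+ 2 *+ d.
    rewrite -[d in X in _ <= X]card_ord -sumr_const; apply: ler_sum => i _.
    by rewrite -expr2 -(real_normK (num_real (w 0 i))) lerXn2r ?nnegrE ?invr_ge0.
  have := phiE 0 w; rewrite wv -/a sub0r !dotE opprK (dotC v a) sum_sgr_norm vv.
  have s0 : 0 <= \sum_i `|a 0 i| by apply: sumr_ge0.
  have a0 := dot_ge0 a; move=> H; apply: dot_eq0; apply/eqP.
  rewrite eq_le a0 andbT; lra.
split=> // i.
have phiD x y : dot (phi x) (phi y) = dot x y.
  have := phiE x y; have := phiE x 0; have := phiE y 0.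
  rewrite phi0 !subr0 !dotE (dotC y x) (dotC (phi y) (phi x)); lra.
have [f fE _] := phiS (delta_mx 0 i).
have entry x : phi x 0 i = dot x f by rewrite -phiD fE dot_deltar.
have ff : dot f f = 1 by rewrite -phiD fE dot_deltal mxE !eqxx.
have s1 : \sum_j `|f 0 j| <= 1.
  have cf : cube (\row_j (2^-1 * (-1) ^+ (f 0 j < 0)%R) : 'rV[R]_d).
    by apply/cubeP => j; rewrite corner_norm ger0_norm ?invr_ge0.
  have /cubeP /(_ i) := phiC _ cf; rewrite entry dotC sum_sgr_norm.
  have s0 : 0 <= \sum_i `|f 0 i| by apply: sumr_ge0.
  rewrite ger0_norm ?mulr_ge0 ?invr_ge0 //; lra.
have f1 j : `|f 0 j| <= 1.
  by apply: le_trans s1; rewrite (bigD1 j) //= lerDl sumr_ge0.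
have fj2 j : 0 <= `|f 0 j| - f 0 j * f 0 j.
  by rewrite subr_ge0 -expr2 -(real_normK (num_real (f 0 j))) expr2 ler_piMr.
have fj j : `|f 0 j| = f 0 j * f 0 j.
  apply/eqP; rewrite -subr_eq0; apply/eqP.
  have H : \sum_j (`|f 0 j| - f 0 j * f 0 j) = 0.
    apply/eqP; rewrite eq_le sumr_ge0 // andbT.
    by rewrite sumrB -[X in _ - X]/(dot f f) ff subr_le0.
  exact: (psumr_eq0P _ H).
have [j fj0] : exists j, f 0 j != 0.
  apply: contrapT => nf; have : dot f f = 0.
    apply: big1 => j _; have [->|fn] := eqVneq (f 0 j) 0; first by rewrite mul0r.
    by case: nf; exists j.
  by rewrite ff => /eqP; rewrite oner_eq0.
have fj1 : `|f 0 j| = 1.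
  have nz : `|f 0 j| != 0 by rewrite normr_eq0.
  apply: (mulfI nz); rewrite mulr1 [RHS]fj -!expr2.
  by rewrite real_normK ?num_real.
exists j, (f 0 j); split=> // x; rewrite entry /dot (bigD1 j) //= mulrC big1 ?addr0 //.
move=> k kj; suff -> : f 0 k = 0 by rewrite mulr0.
apply/eqP; rewrite -normr_le0; move: s1.
rewrite (bigD1 j) //= fj1 (bigD1 k) //= => H.
have S0 : 0 <= \sum_(l | (l != j) && (l != k)) `|f 0 l| by apply: sumr_ge0.
by move: S0 H; set S := \sum_(l | _) _ => S0 H; lra.
Qed.

Lemma prototile_symmetry h : hyp_isometry h ->
  h @` @prototile R d = @prototile R d ->
  exists phi, [/\ forall p, base (h p) = phi (base p), phi 0 = 0 &
                  signed_entries phi].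
Proof.
move=> hi hB; have [g [hK gK gi]] := isometry_inv hi.
have hh : forall p, height (h p) = 1 * height p.
  by move=> p; rewrite mul1r; apply: prototile_symmetry_height; rewrite // hB.
have [phi [bh phiE]] := isometry_scaling hi ltr01 hh.
pose m x : hyp := mkhyp x (ltr01 : 0 < 1 :> R).
have mB x : prototile (m x) <-> cube x.
  rewrite prototileP cubeP; split=> [[]//|cx]; split=> //.
  by rewrite height_mkhyp lexx andbT; lra.
have phiC x : cube x -> cube (phi x).
  move=> /mB cx; rewrite -[x]/(base (m x)) -bh; apply/cubeP.
  by have /prototileP[] : prototile (h (m x)) by rewrite -hB; exists (m x).
have phiS x : exists2 y, phi y = x & cube x -> cube y.
  exists (base (g (m x))); first by rewrite -bh gK.
  move=> /mB; rewrite -hB => -[q Bq <-]; rewrite hK; apply/cubeP.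
  by have /prototileP[] := Bq.
have [phi0 sphi] := cube_isometry_signed (fun x y => etrans (phiE x y)
  (etrans (congr1 (fun z => z * _) (expr1n _ _)) (mul1r _))) phiC phiS.
by exists phi.
Qed.

End SignedPermutations.

(** * Tilings *)

Section LocalFiniteness.
Variables (R : realType) (d : nat).
Notation hyp := (hyp R d).
Implicit Types (p q r o : hyp) (f g h : hyp -> hyp) (t : set hyp).

Lemma coshd_bounds p o (C : R) : coshd p o <= C ->
  [/\ height p <= 2 * C * height o, height o <= 2 * C * height p &
      forall i, `|base p 0 i - base o 0 i| <= 2 * C * height o].
Proof.
have p0 := height_gt0 p; have o0 := height_gt0 o => H.
have C1 : 1 <= C by exact: le_trans (coshd_ge1 p o) H.
move: H; rewrite /coshd ler_pdivrMr ?mulr_gt0 // => H.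
have D0 := dot_ge0 (base p - base o).
have e1 : height p <= 2 * C * height o.
  rewrite -(ler_pM2r p0); have := sqr_ge0 (height o); lra.
have e2 : height o <= 2 * C * height p.
  rewrite -(ler_pM2r o0); have := sqr_ge0 (height p); lra.
split=> // i.
have C0 : 0 <= 2 * C * height o by rewrite !mulr_ge0 // ltW //; lra.
rewrite -[leRHS]ger0_norm // -ler_sqr ?nnegrE // !real_normK ?num_real //.
have := dot_entry (base p - base o) i; rewrite !mxE => E.
apply: (le_trans E); apply: (@le_trans _ _ (C * (2 * height p * height o))).
  have := sqr_ge0 (height o); have := sqr_ge0 (height p); lra.
have -> : C * (2 * height p * height o) = height p * (2 * C * height o) by ring.
by rewrite expr2 ler_wpM2r.
Qed.

(** Quantitative total boundedness: the bounded region is cut into finitely many cells of side e,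
    and the key of an element is the cell of its point. *)
Lemma grid_finite (S : Type) (c : S -> hyp) o (M m n : R) : 0 < m -> 0 < n ->
  exists (K : finType) (key : S -> K), forall s s',
    (forall i, `|base (c s) 0 i - base o 0 i| <= M) ->
    (forall i, `|base (c s') 0 i - base o 0 i| <= M) ->
    m <= height (c s) <= M -> m <= height (c s') <= M ->
    key s = key s' -> coshd (c s) (c s') < 1 + n.
Proof.
move=> m0 n0.
have d1 : 0 < d.+1%:R :> R by rewrite ltr0n.
(* Within a cell [coshd] exceeds 1 by at most (d + 1) e^2 / (2 m^2), which is less than n since e <=
   1. *)
pose e := Num.min 1 (n * m ^+ 2 / d.+1%:R).
have e0 : 0 < e by rewrite lt_min ltr01 divr_gt0 ?mulr_gt0 ?exprn_gt0.
have e1 : e <= 1 by rewrite ge_min lexx.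
have en : d.+1%:R * e <= n * m ^+ 2.
  by rewrite mulrC -ler_pdivlMr // ge_min lexx orbT.
pose L := Num.truncn (2 * M / e).
pose cell (x : R) : 'I_L.+1 := inord (Num.truncn (x / e)).
have cellP x y : 0 <= x <= 2 * M -> 0 <= y <= 2 * M -> cell x = cell y ->
    `|x - y| < e.
  move=> /andP[x0 xM] /andP[y0 yM].
  have tr z : 0 <= z -> z <= 2 * M -> (Num.truncn (z / e) < L.+1)%N.
    move=> z0 zM; rewrite -(ltr_nat R).
    have ze : 0 <= z / e by rewrite divr_ge0 // ltW.
    have Me : 0 <= 2 * M / e by rewrite divr_ge0 ?(ltW e0) // (le_trans z0).
    have /andP[h1 _] := truncn_itv ze; have /andP[_ h2] := truncn_itv Me.
    apply: (le_lt_trans h1); apply: le_lt_trans h2.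
    by rewrite ler_wpM2r // invr_ge0 ltW.
  move=> /(congr1 val); rewrite /= !inordK ?tr // => E.
  have xe : 0 <= x / e by rewrite divr_ge0 // ltW.
  have ye : 0 <= y / e by rewrite divr_ge0 // ltW.
  have := truncn_itv xe; have := truncn_itv ye; rewrite E -natr1.
  move=> /andP[a1 a2] /andP[b1 b2].
  rewrite -[x](divfK (lt0r_neq0 e0)) -[y](divfK (lt0r_neq0 e0)) -mulrBl.
  rewrite normrM (gtr0_norm e0) -[ltRHS]mul1r ltr_pM2r //.
  by rewrite ltr_norml; apply/andP; split; lra.
exists ({ffun 'I_d -> 'I_L.+1} * 'I_L.+1)%type.
exists (fun s => ([ffun i => cell (base (c s) 0 i - base o 0 i + M)],
                  cell (height (c s)))).
move=> s s' bs bs' /andP[ms sM] /andP[ms' s'M] [/ffunP kb kh].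
have h0 := height_gt0 (c s); have h0' := height_gt0 (c s').
have bi i : `|base (c s) 0 i - base (c s') 0 i| < e.
  have := kb i; rewrite !ffunE => /cellP.
  have := bs i; have := bs' i; rewrite !ler_norml => /andP[? ?] /andP[? ?].
  rewrite (_ : _ + M - _ = base (c s) 0 i - base (c s') 0 i); last by ring.
  by apply; apply/andP; split; lra.
have he : `|height (c s) - height (c s')| < e.
  by apply: cellP => //; apply/andP; split; lra.
have sq (x : R) : `|x| < e -> x ^+ 2 <= e ^+ 2.
  by move=> xe; rewrite -(real_normK (num_real x)) lerXn2r ?nnegrE ?(ltW e0) ?(ltW xe).
have D : dot (base (c s) - base (c s')) (base (c s) - base (c s')) <= d%:R * e ^+ 2.
  rewrite mulr_natl -[d in X in _ <= X]card_ord -sumr_const; apply: ler_sum => i _.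
  by rewrite -expr2 !mxE; exact: sq.
have hs := sq _ he.
have ee : e ^+ 2 <= e by rewrite expr2 ler_piMl // ltW.
have de : d%:R * e ^+ 2 <= d%:R * e by rewrite ler_wpM2l.
have mm : m ^+ 2 <= height (c s) * height (c s').
  by rewrite expr2; apply: ler_pM; rewrite ?(ltW m0).
have nm : n * m ^+ 2 <= n * (height (c s) * height (c s')).
  by rewrite ler_wpM2l // ltW.
have nm0 : 0 < n * m ^+ 2 by rewrite mulr_gt0 ?exprn_gt0.
move: en; rewrite -natr1 => en.
rewrite /coshd ltr_pdivrMr ?mulr_gt0 //; lra.
Qed.

(** Every tile contains a ball of fixed size about its centre, and the centres of the tiles
    considered stay in a bounded region. Centres in the same cell of the grid are so close that the
    balls overlap, hence a cell determines its tile. *)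
Lemma tiles_finite (T : set (set hyp)) o (C : R) : tiling T ->
  finite_set [set t | T t /\ exists2 p, t p & coshd p o <= C].
Proof.
move=> tT; have [tileT _ _] := tT.
(* Height 3/4 leaves a margin of 1/4 to both horospheres of the prototile, the size of the box in
   [cball_center]. *)
have y0 : 0 < 3 / 4 :> R by lra.
pose c0 : hyp := mkhyp 0 y0.
have [n n0 cB] := cball_center (0 : 'rV[R]_d) y0.
have {}cB : cball c0 n `<=` @prototile R d.
  move=> q /cB[bq hq]; apply/prototileP; split=> [i|].
    by have := bq i; rewrite mxE subr0 => ?; lra.
  by move: hq; rewrite ltr_norml => /andP[? ?]; apply/andP; split; lra.
have /choice[ctr ctrP] : forall t : set hyp, exists c : hyp, T t ->
    exists g, [/\ hyp_isometry g, t = g @` @prototile R d & c = g c0].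
  move=> t.
  have [Tt|nT] := pselect (T t); last by exists c0.
  by have [g gi tg] := tileT _ Tt; exists (g c0) => _; exists g.
(* A crude bound for [coshd] between the centre and any point of a tile. *)
pose C0 : R := 2 * d%:R + 3.
have C03 : 3 <= C0 by rewrite lerDr mulr_ge0.
have ctrC t p : T t -> t p -> coshd (ctr t) p <= C0.
  move=> /ctrP[g [gi -> ->]] [q /prototileP[bq /andP[h1 h2]] <-].
  rewrite (isometry_coshd _ _ gi) coshdC /coshd base_mkhyp height_mkhyp subr0.
  have D : dot (base q) (base q) <= d%:R.
    rewrite -[d in X in _ <= X]card_ord -sumr_const; apply: ler_sum => i _.
    rewrite -expr2 -(real_normK (num_real _)) expr_le1 //.
    by apply: le_trans (bq i) _; lra.
  have q0 := height_gt0 q; have d0 : 0 <= d%:R :> R by [].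
  rewrite ler_pdivrMr; last by rewrite !mulr_gt0.
  have h22 : height q ^+ 2 <= 1 by rewrite expr_le1 // ltW.
  have : 2^-1 * C0 <= height q * C0 by rewrite ler_wpM2r //; lra.
  rewrite /C0; lra.
(* Both bounds come from two uses of [coshd_bounds]: from o to p, then from p to the centre of its
   tile. *)
pose M := 2 * C * height o + 2 * C0 * (2 * C * height o).
pose m := height o / (2 * C * (2 * C0)).
have bd t p : T t -> t p -> coshd p o <= C ->
    [/\ 1 <= C, forall i, `|base (ctr t) 0 i - base o 0 i| <= M &
        m <= height (ctr t) <= M].
  move=> Tt tp pC; have [a1 a2 a3] := coshd_bounds pC.
  have [b1 b2 b3] := coshd_bounds (ctrC _ _ Tt tp).
  have C1 : 1 <= C by exact: le_trans (coshd_ge1 p o) pC.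
  have o0 := height_gt0 o; have p0 := height_gt0 p.
  have pM : 2 * C0 * height p <= 2 * C0 * (2 * C * height o).
    by rewrite ler_wpM2l //; lra.
  have Co : 0 <= 2 * C * height o by rewrite !mulr_ge0 // ?ltW //; lra.
  split=> // [i|].
    have := ler_distD (base p 0 i) (base (ctr t) 0 i) (base o 0 i).
    by have := a3 i; have := b3 i; rewrite /M; lra.
  apply/andP; split; last by rewrite /M; lra.
  rewrite /m ler_pdivrMr; last by rewrite !mulr_gt0 //; lra.
  apply: (le_trans a2).
  have : 2 * C * height p <= 2 * C * (2 * C0 * height (ctr t)).
    by rewrite ler_wpM2l //; lra.
  by move=> h; apply: (le_trans h); rewrite le_eqVlt; apply/orP; left; apply/eqP; ring.
have [C1|nC] := leP 1 C; last first.
  rewrite (_ : [set t | _] = set0) //; apply/seteqP; split=> // t [Tt [p tp pC]].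
  by have [] := bd t p Tt tp pC; rewrite leNgt nC.
have m0 : 0 < m.
  by rewrite divr_gt0 ?height_gt0 // !mulr_gt0 //; lra.
have [K [key keyP]] := grid_finite ctr o M m0 n0.
set S := [set t | _].
have inj t t' : S t -> S t' -> key t = key t' -> t = t'.
  move=> [Tt [p tp pC]] [Tt' [p' tp' pC']] kk.
  have [_ b1 b2] := bd t p Tt tp pC; have [_ b1' b2'] := bd t' p' Tt' tp' pC'.
  have cc := keyP _ _ b1 b1' b2 b2' kk.
  have [g [gi tg cg]] := ctrP _ Tt; have [g' [gi' tg' cg']] := ctrP _ Tt'.
  apply: (@tiling_overlap _ _ T t t' (ctr t) (ctr t') (ctr t) n n) => //.
  - by rewrite /cball /= coshdxx ltrDl.
  - by rewrite cg tg; exact: cball_image.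
  - by rewrite cg' tg'; exact: cball_image.
have sub : S `<=` (fun k => xget set0 [set t | S t /\ key t = k]) @` [set: K].
  move=> t St; exists (key t) => //; case: xgetP => [t' -> [St' /inj]|/(_ t)[]//].
  by apply.
by apply: sub_finite_set sub _; apply: finite_image; exact: finite_finset.
Qed.

End LocalFiniteness.

(** * Faces of the prototile and the rigidity of b-facets *)

Section Faces.
Variables (R : realType) (d : nat).
Hypothesis d0 : (0 < d)%N.
Notation hyp := (hyp R d).
Implicit Types (p q r o : hyp) (f g h k : hyp -> hyp) (x : 'rV[R]_d).
Implicit Types (sg : 'I_d -> bool) (F : set hyp).

Definition orthant sg : set 'rV[R]_d := box (orthant_lo R sg) (orthant_hi R sg).

(** For e >= 0, the point of the orthant of [sg] with all coordinates of absolute value e; e = 1/4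
    gives the centre of a b-facet. *)
Definition sgvec sg (e : R) : 'rV[R]_d := \row_i (e * (-1) ^+ (~~ sg i)).

Lemma sgvecE sg e i : (-1) ^+ (~~ sg i) * sgvec sg e 0 i = e.
Proof. by rewrite mxE mulrCA -expr2 sqrr_sign mulr1. Qed.

Lemma orthantP sg x :
  orthant sg x <-> forall i, 0 <= (-1) ^+ (~~ sg i) * x 0 i <= 2^-1.
Proof.
have E i : (orthant_lo R sg 0 i <= x 0 i <= orthant_hi R sg 0 i) =
    (0 <= (-1) ^+ (~~ sg i) * x 0 i <= 2^-1).
  rewrite !mxE; case: (sg i) => /=; rewrite ?expr0 ?mul1r // expr1 mulN1r.
  by rewrite oppr_ge0 lerNl andbC.
by split=> H i; have := H i; rewrite E.
Qed.

Lemma orthant_sgvec sg e : 0 <= e <= 2^-1 -> orthant sg (sgvec sg e).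
Proof. by move=> eb; apply/orthantP => i; rewrite sgvecE. Qed.

Lemma box_faceP (l u : 'rV[R]_d) (n : nat) (F : set 'rV[R]_d) : box_face l u n F ->
  (n = d /\ F = box l u) \/
  exists i v, (v = l 0 i \/ v = u 0 i) /\ forall x, F x -> x 0 i = v.
Proof.
move=> [s [sk ->]]; have [all_none|] := pselect (forall i, s i = None).
  left; split.
    by rewrite -sk -[RHS]card_ord; apply: eq_card => i; rewrite !inE all_none.
  by congr box; apply/rowP => i; rewrite mxE all_none.
move=> /existsNP[i si]; right; exists i.
case E: (s i) si => [b|//] _; exists (if b then u 0 i else l 0 i); split.
  by case: b {E}; [right|left].
move=> x /(_ i); rewrite !mxE E.
by case: b {E} => /= /andP[a b]; apply/eqP; rewrite eq_le a b.
Qed.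

(** Lower-dimensional faces and c-facets are treated alike, through a vertical hyperplane x_i = v
    containing them. The values of v are recorded because they differ from the coordinates 1/4 and
    -1/4 of the centre of a b-facet. *)
Lemma prototile_faceP F : prototile_face F ->
  [\/ exists i v, (`|v| = 2^-1 \/ v = 0) /\ forall q, F q -> base q 0 i = v,
      F = hyp_prod (@cube R d) [set 1] |
      exists sg, F = hyp_prod (orthant sg) [set 2^-1]].
Proof.
have half : `|2^-1 : R| = 2^-1 by rewrite ger0_norm ?invr_ge0.
have cv i v : v = cube_lo R d 0 i \/ v = cube_hi R d 0 i -> `|v| = 2^-1.
  by case=> ->; rewrite mxE ?normrN half.
case=> [[k [F0 [/box_faceP fF ->]]]|[sg [k [F0 [/box_faceP fF ->]]]]|
        [k [F0 [kd /box_faceP fF ->]]]].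
- case: fF => [[_ ->]|[i [v [/cv vE Fv]]]]; first by constructor 2.
  by constructor 1; exists i, v; split; [left|move=> q [/Fv]].
- case: fF => [[_ ->]|[i [v [vE Fv]]]]; first by constructor 3; exists sg.
  constructor 1; exists i, v; split; last by move=> q [/Fv].
  by case: vE => ->; rewrite mxE; case: (sg i); rewrite ?normrN; auto.
- case: fF => [[kE _]|[i [v [/cv vE Fv]]]]; first by rewrite kE ltnn in kd.
  by constructor 1; exists i, v; split; [left|move=> q [/Fv]].
Qed.

(** The facet contains a segment from the axis in each coordinate direction. Along it the functional
    is a quadratic polynomial in e, and equal values at e = 0, 1/4 and 1/2 annihilate the linear and
    quadratic coefficients. *)
Lemma hlin_const_b_facet sg a (b : 'rV[R]_d) c m :
  (forall p, hyp_prod (orthant sg) [set 2^-1] p -> hlin a b c p = m) ->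
  [/\ b = 0, c = 0 & m = 2 * a].
Proof.
move=> H; have half0 : 0 < 2^-1 :> R by rewrite invr_gt0.
pose pt i (e : R) : hyp := mkhyp ((e * (-1) ^+ (~~ sg i)) *: delta_mx 0 i) half0.
have Hpt i e : 0 <= e <= 2^-1 ->
    2 * (a + (e * (-1) ^+ (~~ sg i)) * b 0 i + c * (e ^+ 2 + 4^-1)) = m.
  move=> eb; rewrite -(H (pt i e)); last first.
    split=> //; apply/orthantP => j; rewrite !mxE eqxx /=.
    have [->|ji] := eqVneq j i; last by rewrite /= !mulr0 lexx /= invr_ge0.
    by rewrite mulr1 mulrCA -expr2 sqrr_sign mulr1.
  rewrite /hlin base_mkhyp height_mkhyp !dotZl !dotZr !dot_deltar mxE !eqxx /=.
  rewrite invrK mulr1 mulrACA -expr2 -expr2 sqrr_sign mulr1.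
  by field.
have z0 : 0 <= (0 : R) <= 2^-1 by apply/andP; split; lra.
have z1 : 0 <= (4^-1 : R) <= 2^-1 by apply/andP; split; lra.
have z2 : 0 <= (2^-1 : R) <= 2^-1 by apply/andP; split; lra.
have bc i : b 0 i = 0 /\ c = 0.
  have e0 := Hpt i 0 z0; have e1 := Hpt i _ z1; have e2 := Hpt i _ z2.
  have sn0 : (-1) ^+ (~~ sg i) != 0 :> R by rewrite signr_eq0.
  move: e0 e1 e2; set s := (-1) ^+ _ => e0 e1 e2.
  have sb : s * b 0 i = 0 by lra.
  split; last by lra.
  by move/eqP: sb; rewrite mulf_eq0 (negPf sn0) => /eqP.
have cz : c = 0 by have [] := bc (Ordinal d0).
split=> //; first by apply/rowP => i; rewrite mxE; have [] := bc i.
by rewrite -(Hpt (Ordinal d0) 0 z0) cz !mul0r !addr0.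
Qed.

(* The hyperboloid points of a b-facet span the whole space, which a face
   contained in a vertical hyperplane does not; and a functional constant on a
   b-facet is a multiple of [1 / height]. *)
Lemma facet_on_b_facet k F sg : hyp_isometry k -> prototile_face F ->
  k @` F = hyp_prod (orthant sg) [set 2^-1] ->
  (F = hyp_prod (@cube R d) [set 1] /\ forall p, height (k p) = 2^-1 * height p) \/
  forall p, height (k p) = height p.
Proof.
move=> ki fF kF; have [l [kK lK li]] := isometry_inv ki.
have lF p : hyp_prod (orthant sg) [set 2^-1] p -> F (l p).
  by rewrite -kF => -[q Fq <-]; rewrite kK.
have scale m : 0 < m -> (forall q, F q -> height q = m) ->
    forall p, height p = 2 * m * height (k p).
  move=> m0 Fm; have [[[a b] c] /= [_ hE]] := isometry_height li.
  have [|b0 c0 aE] := @hlin_const_b_facet sg a b c m^-1.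
    by move=> p /lF /Fm <-; rewrite hE.
  move=> p; have := hE (k p); rewrite kK /hlin b0 c0 dot0l !addr0 mul0r addr0.
  have -> : a = 2^-1 * m^-1 by rewrite aE; field.
  move=> /(congr1 GRing.inv); rewrite invrK => ->.
  by field; rewrite height_neq0 gt_eqF.
case: (prototile_faceP fF) => [[i [v [_ Fv]]]|Fa|[tau Fb]].
(* The functional (x_i - v) / height vanishes on F. Transported by [l] it vanishes on the b-facet,
   hence everywhere; but it is 1 at q. *)
- have [a [b [c E]]] := isometry_hlin (- v) (delta_mx 0 i) 0 li.
  have [|b0 c0 a0] := @hlin_const_b_facet sg a b c 0.
    move=> p /lF /Fv lp; rewrite -E /= /hlin dot_deltal lp mul0r addr0.
    by rewrite addNr mul0r.
  pose q : hyp := mkhyp ((v + 1) *: delta_mx 0 i) (ltr01 : 0 < 1 :> R).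
  have := E (k q); rewrite /= kK /hlin b0 c0 dot0l.
  rewrite base_mkhyp height_mkhyp dotZr dot_deltal mxE !eqxx /= => H.
  have a00 : a = 0 by lra.
  by move: H; rewrite a00 !mul0r !addr0 mul0r invr1 !mulr1 addKr => /eqP; rewrite oner_eq0.
- left; split=> // p; rewrite (scale 1 _ _ p) //; first by field.
  by move=> q; rewrite Fa => -[_ hq]; exact: hq.
- right=> p; rewrite [RHS](scale 2^-1 _ _ p) ?invr_gt0 //; first by field.
  by move=> q; rewrite Fb => -[_ hq]; exact: hq.
Qed.

End Faces.

(** * Children of a tile *)

Section Children.
Variables (R : realType) (d : nat).
Hypothesis d0 : (0 < d)%N.
Notation hyp := (hyp R d).
Implicit Types (p q r o : hyp) (f g h k : hyp -> hyp) (x : 'rV[R]_d).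
Implicit Types (sg : 'I_d -> bool) (F : set hyp) (T : set (set hyp)).

Definition child_region sg : set hyp := hyp_prod (orthant sg) `[4^-1, 2^-1].

Lemma child_regionP sg p :
  child_region sg p <-> orthant sg (base p) /\ 4^-1 <= height p <= 2^-1.
Proof. by split=> -[op hp]; split=> //; move: hp; rewrite /= in_itv. Qed.

Lemma half_height_gt0 p : 0 < 2^-1 * height p.
Proof. by rewrite mulr_gt0 ?invr_gt0 ?height_gt0. Qed.

(** The homothety of ratio 1/2 centred at the boundary point [sgvec sg 2^-1]. *)
Definition child_map sg p : hyp :=
  mkhyp (2^-1 *: base p + sgvec sg 4^-1) (half_height_gt0 p).

Lemma child_map_isometry sg : hyp_isometry (child_map sg).
Proof.
apply/hyp_isometryP; split; last first.
  move=> p q; rewrite /coshd !base_mkhyp !height_mkhyp opprD addrACA subrr addr0.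
  by rewrite -scalerBr !dotE; field; rewrite !height_neq0.
have h2 p : 0 < 2 * height p by rewrite mulr_gt0 ?height_gt0.
exists (fun p => mkhyp (2 *: (base p - sgvec sg 4^-1)) (h2 p)) => p.
  apply: hyp_eqP; rewrite ?base_mkhyp ?height_mkhyp.
    by rewrite addrK scalerA divff ?pnatr_eq0 // scale1r.
  by rewrite mulrA divff ?pnatr_eq0 // mul1r.
apply: hyp_eqP; rewrite ?base_mkhyp ?height_mkhyp.
  by rewrite scalerA mulVf ?pnatr_eq0 // scale1r subrK.
by rewrite mulrA mulVf ?pnatr_eq0 // mul1r.
Qed.

Lemma child_map_image sg : child_map sg @` @prototile R d = child_region sg.
Proof.
have E p i : (-1) ^+ (~~ sg i) * base (child_map sg p) 0 i =
    2^-1 * ((-1) ^+ (~~ sg i) * base p 0 i) + 4^-1.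
  rewrite base_mkhyp mxE mulrDr sgvecE mxE; ring.
have N p i : `|(-1) ^+ (~~ sg i) * base p 0 i| = `|base p 0 i|.
  exact: normrMsign.
apply/seteqP; split=> [_ [p /prototileP[bp /andP[hp hp']] <-]|p].
  apply/child_regionP; split; last by rewrite height_mkhyp; apply/andP; split; lra.
  apply/orthantP => i; rewrite E.
  by have := bp i; rewrite -N ler_norml => /andP[a b]; apply/andP; split; lra.
move=> /child_regionP[/orthantP op hp].
have [g [_ gK _]] := isometry_inv (child_map_isometry sg).
exists (g p) => //; apply/prototileP; split=> [i|].
  have := op i; rewrite -{1 2}(gK p) E -N => /andP[a b].
  by rewrite ler_norml; apply/andP; split; lra.
by move: hp; rewrite -{1 2}(gK p) height_mkhyp => /andP[a b];
  apply/andP; split; lra.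
Qed.

(** Infinite pigeonhole, for finding a tile that contains infinitely many terms of a sequence of
    points. *)
Lemma finite_frequent (I : choiceType) (S : set I) (P : I -> nat -> Prop) :
  finite_set S -> (forall n, exists2 t, S t & P t n) ->
  exists2 t, S t & forall N, exists2 n, (N <= n)%N & P t n.
Proof.
move=> /finite_seqP[s ->] SP; apply: contrapT => nP.
have {nP} H t : t \in s -> exists N, forall n, (N <= n)%N -> ~ P t n.
  move=> ts; apply: contrapT => nN; apply: nP; exists t => // N.
  apply: contrapT => nn; apply: nN; exists N => n Nn Ptn; apply: nn.
  by exists n.
have [N HN] : exists N, forall t, t \in s -> forall n, (N <= n)%N -> ~ P t n.
  elim: s H {SP} => [|t s IH] H; first by exists 0%N.
  have [|N HN] := IH; first by move=> u us; apply: H; rewrite inE us orbT.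
  have [M HM] := H t (mem_head t s); exists (maxn N M) => u; rewrite inE.
  move=> /orP[/eqP->|us] n; rewrite geq_max => /andP[Nn Mn]; first exact: HM.
  exact: HN us _ Nn.
by have [t ts] := SP N; exact: HN.
Qed.

(** As x has no zero coordinate, its orthant and that of [phi x] determine the signs in [phi]: the
    factor [u * e * s], of absolute value 1, is non-negative and so equals 1. *)
Lemma signed_orthant (phi : 'rV[R]_d -> 'rV[R]_d) x sg tau :
  signed_entries phi -> orthant sg x -> (forall i, x 0 i != 0) ->
  orthant tau (phi x) -> forall w, orthant sg w -> orthant tau (phi w).
Proof.
move=> sphi /orthantP ox xn0 /orthantP ophi w /orthantP ow; apply/orthantP => i.
have [j [e [e1 phiE]]] := sphi i.
have := ophi i; rewrite !phiE => /andP[+ _].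
have /andP[xj _] := ox j; have := ow j.
set s := (-1) ^+ (~~ sg j) in xj *; set u := (-1) ^+ (~~ tau i) => wj.
have ss : s * s = 1 by rewrite -expr2 sqrr_sign.
have sx : 0 < s * x 0 j by rewrite lt_def xj mulf_neq0 ?xn0 ?signr_eq0.
have -> : u * (e * x 0 j) = u * e * s * (s * x 0 j).
  by transitivity (u * e * (s * s) * x 0 j); [rewrite ss|]; ring.
rewrite pmulr_lge0 // => ues.
have ues1 : u * e * s = 1.
  by rewrite -[LHS]ger0_norm // !normrM e1 !normr_sign !mulr1.
suff -> : u * (e * w 0 j) = s * w 0 j by [].
transitivity (u * e * s * (s * w 0 j)); last by rewrite ues1 mul1r.
by transitivity (u * e * (s * s) * w 0 j); [rewrite ss|]; ring.
Qed.

End Children.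

Section ChildTiles.
Variables (R : realType) (d : nat).
Hypothesis d0 : (0 < d)%N.
Notation hyp := (hyp R d).
Implicit Types (p q r o : hyp) (f g h k : hyp -> hyp) (x : 'rV[R]_d).
Implicit Types (sg : 'I_d -> bool) (F : set hyp) (T : set (set hyp)).

Lemma image_symmetry g g' h : cancel g h -> cancel h g ->
  g @` @prototile R d = g' @` @prototile R d ->
  (h \o g') @` @prototile R d = @prototile R d.
Proof.
move=> gK hK E; rewrite -image_comp -E image_comp (_ : h \o g = id) ?image_id //.
exact/funext.
Qed.

(* Faces of a tile are images of prototile faces under any isometry onto the
   tile; those isometries differ by a symmetry of the prototile, which acts on
   the base as a signed permutation and so permutes the orthants. *)
Lemma tile_face_b_facet g E sg (half0 : 0 < 2^-1 :> R) : hyp_isometry g ->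
  tile_face (g @` @prototile R d) E -> E (g (mkhyp (sgvec sg 4^-1) half0)) ->
  E = g @` hyp_prod (orthant sg) [set 2^-1].
Proof.
have n1 : (2^-1 : R) <> 4^-1 by move=> ?; lra.
have n2 : (0 : R) <> 4^-1 by move=> ?; lra.
have n3 : (1 : R) <> 2^-1 by move=> ?; lra.
move=> gi [g1 [F1 [g1i gB fF1 EF1]]] Ep.
set p := mkhyp _ _ in Ep.
have [gv [gK gvK gvi]] := isometry_inv gi.
have [g1v [g1K g1vK g1vi]] := isometry_inv g1i.
pose h := gv \o g1; pose h' := g1v \o g.
have hK : cancel h h' by move=> q; rewrite /h /h' /= gvK g1K.
have h'K : cancel h' h by move=> q; rewrite /h /h' /= g1vK gK.
have hi : hyp_isometry h by exact: isometry_comp.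
have h'i : hyp_isometry h' by exact: isometry_comp.
have hB : h @` @prototile R d = @prototile R d by exact: image_symmetry gK gvK gB.
have h'B : h' @` @prototile R d = @prototile R d.
  exact: image_symmetry g1K g1vK (esym gB).
have hh q : height (h q) = height q.
  by apply: prototile_symmetry_height; rewrite // hB.
have h'h q : height (h' q) = height q.
  by apply: prototile_symmetry_height; rewrite // h'B.
have [phi [bh _ sphi]] := prototile_symmetry d0 hi hB.
have [psi [bh' _ spsi]] := prototile_symmetry d0 h'i h'B.
have Eh : E = g @` (h @` F1).
  rewrite EF1 image_comp; apply: eq_imagel => q _; by rewrite /h /= gvK.
have F1p : F1 (h' p).
  move: Ep; rewrite Eh => -[_ [q Fq <-] /(can_inj gK) <-].
  by rewrite hK.
(* Symmetries keep the absolute values of the coordinates, all 1/4, and the height 1/2. This rules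
   out faces in a hyperplane x_i = v and the a-facet. *)
have p4 i : `|base p 0 i| = 4^-1.
  by rewrite base_mkhyp mxE normrM normr_sign mulr1 ger0_norm ?invr_ge0.
have p'4 i : `|base (h' p) 0 i| = 4^-1.
  by rewrite bh'; have [j [e [e1 ->]]] := spsi i; rewrite normrM e1 mul1r p4.
have nz (v : R) : `|v| = 4^-1 -> v != 0 by move=> v4; rewrite -normr_eq0 v4 invr_eq0 pnatr_eq0.
have op : orthant sg (base p).
  by apply: orthant_sgvec; apply/andP; split; lra.
rewrite Eh; congr (g @` _).
case: (prototile_faceP fF1) => [[i [v [vE Fv]]]|Fa|[tau Fb]].
- have := p'4 i; rewrite (Fv _ F1p); case: vE => ->; last rewrite normr0.
    by move/n1.
  by move/n2.
- have h1 : height (h' p) = 1 by move: F1p; rewrite Fa => -[_ hp]; exact: hp.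
  by move: h1; rewrite h'h height_mkhyp => /esym/n3.
move: F1p; rewrite Fb => -[obase _].
have opsi : orthant tau (psi (base p)) by rewrite -bh'.
apply/seteqP; split=> [_ [q [oq hq] <-]|q [oq hq]].
  split; last by change (height (h q) = 2^-1); rewrite hh.
  change (orthant sg (base (h q))); rewrite bh.
  apply: (@signed_orthant _ _ phi (base (h' p)) tau sg sphi) => //.
    by move=> i; apply: nz.
  by rewrite -bh h'K.
exists (h' q); last exact: h'K.
split; last by change (height (h' q) = 2^-1); rewrite h'h.
change (orthant tau (base (h' q))); rewrite bh'.
apply: (@signed_orthant _ _ psi (base p) sg tau spsi) => //.
by move=> i; apply: nz.
Qed.

(** Points [pn] descend to the centre p of the b-facet from below. By local finiteness one tile t
    contains infinitely many of their images, and by closedness that of p. Then t meets the parent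
    in a common face through that centre, which is the b-facet, and [facet_on_b_facet] leaves two
    positions for t. *)
Lemma child_tile T g sg : tiling T -> face_to_face T -> hyp_isometry g ->
  T (g @` @prototile R d) -> T (g @` child_region sg).
Proof.
move=> tT ffT gi Tg; have [tileT covT _] := tT.
have half0 : 0 < 2^-1 :> R by rewrite invr_gt0.
(* Starting at 1/4 keeps the heights of the points [pn] positive. *)
have e0 n : 0 < n.+4%:R^-1 :> R by rewrite invr_gt0.
have e4 n : n.+4%:R^-1 <= 4^-1 :> R by rewrite lef_pV2 ?posrE // ler_nat.
have y0 n : 0 < 2^-1 - n.+4%:R^-1 :> R by have := e4 n; move: (n.+4%:R^-1 : R) => e; lra.
pose p : hyp := mkhyp (sgvec sg 4^-1) half0.
pose pn n : hyp := mkhyp (sgvec sg 4^-1) (y0 n).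
have pnp n : coshd (pn n) p <= 1 + n.+4%:R^-1.
  rewrite /coshd !base_mkhyp !height_mkhyp subrr dot0l add0r.
  rewrite ler_pdivrMr ?mulr_gt0 //.
  have := e0 n; have := e4 n; move: (n.+4%:R^-1 : R) => e; nra.
have [gv [gK gvK gvi]] := isometry_inv gi.
have Bp : prototile p.
  apply/prototileP; split=> [i|]; last by rewrite height_mkhyp lexx /=; lra.
  rewrite base_mkhyp mxE normrM normr_sign mulr1 ger0_norm ?invr_ge0 //; lra.
have [t [Tt _] ft] : exists2 t, T t /\ (exists2 q, t q & coshd q (g p) <= 2) &
    forall N, exists2 n, (N <= n)%N & t (g (pn n)).
  apply: (finite_frequent (P := fun t n => t (g (pn n)))).
    exact: (@tiles_finite R d T (g p) 2 tT).
  move=> n; have : [set: hyp] (g (pn n)) by [].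
  rewrite -covT => -[t Tt tp]; exists t => //; split=> //; exists (g (pn n)) => //.
  by rewrite (isometry_coshd _ _ gi); have := pnp n; have := e4 n; move: (n.+4%:R^-1 : R) => e; lra.
have gt : g @` @prototile R d <> t.
  have [n _ tn] := ft 0%N; move=> E; move: tn; rewrite -E => -[q Bq].
  move=> /(can_inj gK) qp; move: Bq; rewrite qp => /prototileP[_].
  by rewrite height_mkhyp => /andP[]; have := e0 n; move: (n.+4%:R^-1 : R) => e; lra.
have [g2 g2i tE] := tileT _ Tt.
have tp : t (g p).
  apply: contrapT; rewrite tE => /(tile_closed g2i)[n n0 H].
  have [m mn] : exists m, m.+4%:R^-1 < n.
    have ni : 0 <= n^-1 by rewrite invr_ge0 ltW.
    exists (Num.truncn n^-1); rewrite -[ltRHS]invrK ltf_pV2 ?posrE ?invr_gt0 //.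
    have /andP[_ lt_n] := truncn_itv ni.
    by apply: (lt_le_trans lt_n); rewrite ler_nat !ltnS leqW // leqW.
  have [k mk tk] := ft m; apply: (H (g (pn k))); last by rewrite -tE.
  rewrite /cball /= (isometry_coshd _ _ gi).
  apply: (le_lt_trans (pnp k)); rewrite ltrD2l; apply: le_lt_trans mn.
  by rewrite lef_pV2 ?posrE // ler_nat.
have [|[fg ft2]] := ffT _ _ Tg Tt gt.
  by move=> I0; have : set0 (g p) by rewrite -I0; split=> //; exists p.
set E := _ `&` _ in fg ft2.
have EE : E = g @` hyp_prod (orthant sg) [set 2^-1].
  by apply: (@tile_face_b_facet g E sg half0) => //; split=> //; exists p.
have [g3 [F [g3i tE3 fF EF]]] := ft2.
pose k := gv \o g3; have ki : hyp_isometry k by exact: isometry_comp.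
have kF : k @` F = hyp_prod (orthant sg) [set 2^-1].
  rewrite /k -image_comp -EF EE image_comp (_ : gv \o g = id) ?image_id //.
  exact/funext.
have tk : t = g @` (k @` @prototile R d).
  rewrite tE3 image_comp; apply: eq_imagel => q _; by rewrite /k /= gvK.
(* If k preserved heights, t would lie above height 1/2 in the coordinates of g and miss every
   [pn]. *)
case: (facet_on_b_facet d0 ki fF kF) => [[Fa kh]|kh]; last first.
  have [n _] := ft 0%N; rewrite tk => -[_ [q Bq <-] /(can_inj gK) kq].
  move/prototileP: Bq => [_ /andP[+ _]]; rewrite -kh kq height_mkhyp.
  by have := e0 n; move: (n.+4%:R^-1 : R) => e; lra.
suff <- : k @` @prototile R d = child_region sg by rewrite -tk.
have [l [kK lK li]] := isometry_inv ki.
have lh q : height (l q) = 2 * height q.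
  by rewrite -[q in RHS]lK kh; field.
have [psi [bl _]] := isometry_scaling li (ltr0n R 2) lh.
(* The inverse of k doubles heights, so only its action on bases remains; it is read off from the
   correspondence of the two facets. *)
have ocE x : orthant sg x <-> cube (psi x).
  pose m : hyp := mkhyp x half0.
  have lm : height (l m) = 1 by rewrite lh height_mkhyp divff ?pnatr_eq0.
  have mE : (k @` F) m <-> orthant sg x by rewrite kF; split=> [[]//|ox]; split.
  rewrite -mE -[x]/(base m) -bl Fa; split=> [[q [cq hq] qm]|cm].
    by rewrite -qm kK.
  by exists (l m); [split|exact: lK].
apply/seteqP; split=> [_ [q Bq <-]|q /child_regionP[/ocE oq hq]].
  apply/child_regionP; rewrite kh ocE -bl kK cubeP.
  by have /prototileP[bq /andP[h1 h2]] := Bq; split=> //; apply/andP; split; lra.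
exists (l q); last exact: lK.
apply/prototileP; rewrite -cubeP bl lh; split=> //.
by move/andP: hq => [h1 h2]; apply/andP; split; lra.
Qed.

(* Both parents lie above the a-facet of the child. *)
Lemma parent_unique T g1 g2 sg1 sg2 : tiling T ->
  hyp_isometry g1 -> hyp_isometry g2 ->
  T (g1 @` @prototile R d) -> T (g2 @` @prototile R d) ->
  g1 @` child_region sg1 = g2 @` child_region sg2 ->
  g1 @` @prototile R d = g2 @` @prototile R d.
Proof.
move=> tT g1i g2i T1 T2; rewrite -!child_map_image !image_comp => E.
have s1i := isometry_comp g1i (child_map_isometry R sg1).
have s2i := isometry_comp g2i (child_map_isometry R sg2).
have [l [sK lK li]] := isometry_inv s2i.
pose h := l \o (g1 \o child_map sg1).
have hi : hyp_isometry h by exact: isometry_comp.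
have hB : h @` @prototile R d = @prototile R d by exact: image_symmetry sK lK (esym E).
have hh q : height (h q) = height q.
  by apply: prototile_symmetry_height; rewrite // hB.
have [phi [bh phi0 _]] := prototile_symmetry d0 hi hB.
(* A point of the axis above the a-facet at height 1, hence fixed by h. Both child maps send it to
   height 3/4 over the centre of an orthant cube, well inside the parent. *)
have c0 : 0 < 3 / 2 :> R by lra.
pose c : hyp := mkhyp 0 c0.
have hc : h c = c by apply: hyp_eqP; rewrite ?hh // bh base_mkhyp phi0.
have gc : g1 (child_map sg1 c) = g2 (child_map sg2 c).
  by rewrite -[c in RHS]hc /h /= -[g2 _]/((g2 \o child_map sg2) _) lK.
have above sg : exists2 n, 0 < n & cball (child_map sg c) n `<=` @prototile R d.
  have [n n0 H] := cball_center (base (child_map sg c)) (height_gt0 (child_map sg c)).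
  exists n => // q /H[bq hq]; apply/prototileP; split=> [i|].
    have := ler_distD (base (child_map sg c) 0 i) (base q 0 i) 0.
    have ci : `|base (child_map sg c) 0 i| = 4^-1.
      rewrite base_mkhyp scaler0 add0r mxE normrM normr_sign mulr1.
      by rewrite ger0_norm ?invr_ge0.
    by have := bq i; rewrite !subr0 ci; lra.
  by move: hq; rewrite !height_mkhyp ltr_norml => /andP[a b]; apply/andP; split; lra.
have [n1 n10 B1] := above sg1; have [n2 n20 B2] := above sg2.
apply: (@tiling_overlap _ _ T _ _ (g1 (child_map sg1 c)) (g2 (child_map sg2 c))
  (g1 (child_map sg1 c)) n1 n2) => //.
- by rewrite /cball /= coshdxx ltrDl.
- by rewrite gc /cball /= coshdxx ltrDl.
- exact: cball_image.
- exact: cball_image.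
Qed.

End ChildTiles.

(** * Orbits of tiles *)

Section Orbits.
Variables (R : realType) (d : nat).
Hypothesis d0 : (0 < d)%N.
Notation hyp := (hyp R d).
Notation B := (@prototile R d).
Variable T : set (set hyp).
Hypothesis hT : B_tiling T.
Implicit Types (p q r o : hyp) (f g h k gam : hyp -> hyp) (t v w : set hyp).
Implicit Types (sg : 'I_d -> bool).

Let G := symmetry_group T.

Let tilingT : tiling T. Proof. by case: hT. Qed.
Let f2fT : face_to_face T. Proof. by case: hT. Qed.

Lemma symmetry_tile gam t : G gam -> T t -> T (gam @` t).
Proof. by move=> [_ E] Tt; rewrite -[X in X _]E; exists t. Qed.

Lemma symmetry_id : G id.
Proof.
split; first by split=> //; exists id.
rewrite (_ : (fun t : set hyp => id @` t) = id) ?image_id //.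
by apply/funext => t; rewrite image_id.
Qed.

Lemma symmetry_inv gam : G gam -> exists gam',
  [/\ cancel gam gam', cancel gam' gam & G gam'].
Proof.
move=> [gi E]; have [g' [gK g'K gi']] := isometry_inv gi; exists g'; split=> //.
split=> //; rewrite -[in LHS]E image_comp (_ : _ \o _ = id) ?image_id //.
by apply/funext => t /=; rewrite image_comp (_ : _ \o _ = id) ?image_id //; exact/funext.
Qed.

Lemma symmetry_comp gam gam' : G gam -> G gam' -> G (gam \o gam').
Proof.
move=> [gi E] [gi' E']; split; first exact: isometry_comp.
rewrite -[RHS]E -[in RHS]E' image_comp; apply: eq_imagel => t _.
by rewrite /= image_comp.
Qed.

Definition orbit_eq t t' := exists2 gam, G gam & t' = gam @` t.

Let orbit_eq_refl t : orbit_eq t t.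
Proof. by exists id; [exact: symmetry_id|rewrite image_id]. Qed.

Let orbit_eq_sym t t' : orbit_eq t t' -> orbit_eq t' t.
Proof.
move=> [gam Gg ->]; have [g' [gK _ Gg']] := symmetry_inv Gg; exists g' => //.
by rewrite image_comp (_ : _ \o _ = id) ?image_id //; exact/funext.
Qed.

Let orbit_eq_trans t t' t'' : orbit_eq t t' -> orbit_eq t' t'' -> orbit_eq t t''.
Proof.
move=> [gam Gg ->] [gam' Gg' ->]; exists (gam' \o gam); first exact: symmetry_comp.
by rewrite image_comp.
Qed.

(** A choice depending only on the orbit, so that orbits can be counted and compared as sets of
    points. *)
Definition orbit_rep t : set hyp := xget set0 [set t' | orbit_eq t t'].

Let orbit_repP t : orbit_eq t (orbit_rep t).
Proof. by rewrite /orbit_rep; case: xgetP => [t' -> //|/(_ t)]; case. Qed.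

Let orbit_rep_eq t t' : orbit_eq t t' <-> orbit_rep t = orbit_rep t'.
Proof.
split=> [tt'|E].
  congr xget; apply/seteqP; split=> u /=; last exact: orbit_eq_trans.
  exact/orbit_eq_trans/orbit_eq_sym.
apply: orbit_eq_trans (orbit_repP t) _; rewrite E; exact/orbit_eq_sym/orbit_repP.
Qed.

Let orbit_repK t : orbit_rep (orbit_rep t) = orbit_rep t.
Proof. exact/esym/orbit_rep_eq/orbit_repP. Qed.

Let orbit_rep_tile t : T t -> T (orbit_rep t).
Proof. by have [gam Gg ->] := orbit_repP t; exact: symmetry_tile. Qed.

(** The image of the first parent under [gam] is a tile sharing a child with the second one, so
    uniqueness of parents applies. *)
Lemma symmetry_parent gam g1 g2 sg1 sg2 : G gam ->
  hyp_isometry g1 -> hyp_isometry g2 -> T (g1 @` B) -> T (g2 @` B) ->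
  g2 @` child_region sg2 = gam @` (g1 @` child_region sg1) ->
  g2 @` B = gam @` (g1 @` B).
Proof.
move=> Gg i1 i2 T1 T2; rewrite !image_comp => E.
apply: (parent_unique d0 tilingT i2 _ T2 _ E); first exact: isometry_comp Gg.1 i1.
by rewrite -image_comp; exact: symmetry_tile.
Qed.

(** Translates of D cover space, so every orbit has a tile that meets D. As D is bounded, local
    finiteness leaves finitely many such tiles. *)
Lemma finitely_many_orbits D : compact D -> fundamental_domain G D ->
  finite_set (orbit_rep @` T).
Proof.
move=> cD [covD _].
pose o : hyp := mkhyp 0 (ltr01 : 0 < 1 :> R).
have [C HC] : exists C : R, forall p, D p -> coshd p o <= C.
  have cI : compact ((fun p => coshd p o) @` D).
    apply: continuous_compact cD.
    by apply: continuous_subspaceT; exact: coshd_continuous.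
  have [M [_ HM]] := compact_bounded cI; exists (M + 1) => p Dp.
  apply: le_trans (ler_norm _) _; apply: (HM (M + 1)); first by rewrite ltrDl.
  by exists p.
apply: (sub_finite_set _ (finite_image orbit_rep (tiles_finite o C tilingT))).
move=> _ [t Tt <-]; have [tileT _ _] := tilingT; have [g gi tE] := tileT _ Tt.
have : [set: hyp] (g o) by [].
rewrite -covD => -[gam Gg [p Dp pE]].
have [g' [gK _ Gg']] := symmetry_inv Gg.
exists (g' @` t); last by apply/esym/orbit_rep_eq; exists g'.
split; first exact: symmetry_tile.
exists p; last exact: HC.
exists (g o); last by rewrite -pE.
rewrite tE; exists o => //; apply/prototileP; split=> [i|].
  by rewrite base_mkhyp mxE normr0 invr_ge0.
by rewrite height_mkhyp lexx andbT; lra.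
Qed.

(** The orbit of a child determines that of its parent ([child_eq]), so passing to one chosen child
    is injective on orbits, and onto by finiteness. The orbit of an arbitrary child is therefore C v
    for some v, and [child_eq] identifies v with the orbit of the parent. *)
Lemma child_orbit_of_tile : finite_set (orbit_rep @` T) ->
  exists C : set hyp -> set hyp, forall g sg, hyp_isometry g -> T (g @` B) ->
    orbit_rep (g @` child_region sg) = C (orbit_rep (g @` B)).
Proof.
have [tileT _ _] := tilingT.
have /choice[gm gmP] : forall t, exists g, T t -> hyp_isometry g /\ t = g @` B.
  move=> t; have [Tt|nT] := pselect (T t); last by exists id.
  by have [g gi tE] := tileT _ Tt; exists g.
pose C t := orbit_rep (gm t @` child_region (fun=> true)).
have VT v : (orbit_rep @` T) v -> T v /\ orbit_rep v = v.
  by move=> [t Tt <-]; split; [exact: orbit_rep_tile|exact: orbit_repK].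
have gmT t : T t -> T (gm t @` child_region (fun=> true)).
  by move=> Tt; have [gi tE] := gmP _ Tt; apply: child_tile => //; rewrite -tE.
have child_eq v g sg : (orbit_rep @` T) v -> hyp_isometry g -> T (g @` B) ->
    orbit_rep (g @` child_region sg) = C v -> orbit_rep (g @` B) = v.
  move=> Vv gi Tg E; have [Tv rv] := VT _ Vv; have [vi vE] := gmP _ Tv.
  have /orbit_rep_eq[gam Gg gE] := esym E.
  rewrite -rv; apply/esym/orbit_rep_eq; exists gam => //.
  by rewrite {1}vE; apply: (symmetry_parent Gg vi gi _ Tg gE); rewrite -vE.
move=> /finite_seqP[s0 Vs0].
set s := undup s0; have us : uniq s by exact: undup_uniq.
have sV v : v \in s <-> (orbit_rep @` T) v by rewrite mem_undup Vs0.
have injC : {in s &, injective C}.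
  move=> v w /sV Vv /sV Vw E; have [Tw rw] := VT _ Vw; have [wi wE] := gmP _ Tw.
  by rewrite -rw {1}wE; apply/esym/(child_eq v _ (fun=> true)) => //; rewrite -?wE.
have sC : {subset map C s <= s}.
  move=> _ /mapP[v /sV Vv ->]; apply/sV; have [Tv _] := VT _ Vv.
  by eexists; [exact: gmT Tv|].
have [_ surjC] : (size (map C s) = size s) * (map C s =i s).
  apply: uniq_min_size => //; last by rewrite size_map.
  by rewrite map_inj_in_uniq.
exists C => g sg gi Tg.
have : orbit_rep (g @` child_region sg) \in s.
  by apply/sV; eexists; [exact: child_tile gi Tg|].
by rewrite -surjC => /mapP[v /sV Vv E]; rewrite (child_eq v g sg).
Qed.

Lemma infinitely_many_orbits : ~ finite_set (orbit_rep @` T).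
Proof.
move=> /child_orbit_of_tile[C CP].
have [tileT covT _] := tilingT.
have y0 : 0 < 4^-1 :> R by rewrite invr_gt0.
have y1 : 0 < 2^-1 :> R by rewrite invr_gt0.
pose q0 : hyp := mkhyp 0 y0.
have : [set: hyp] q0 by [].
rewrite -covT => -[t Tt _]; have [g gi tE] := tileT _ Tt.
have Tg : T (g @` B) by rewrite -tE.
pose sg : 'I_d -> bool := fun=> true; pose tau : 'I_d -> bool := fun=> false.
pose g1 := g \o child_map sg.
have g1i : hyp_isometry g1 by apply: isometry_comp => //; exact: child_map_isometry.
have g1B : g1 @` B = g @` child_region sg by rewrite -child_map_image image_comp.
have Tg1 : T (g1 @` B) by rewrite g1B; exact: child_tile.
have /orbit_rep_eq[gam Gg gE] :
    orbit_rep (g1 @` child_region tau) = orbit_rep (g1 @` child_region sg).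
  by rewrite !CP.
have := symmetry_parent Gg g1i g1i Tg1 Tg1 gE; rewrite g1B => gE1.
have gE2 := symmetry_parent Gg gi gi Tg Tg gE1.
have [gv [gK gvK gvi]] := isometry_inv gi.
pose h := gv \o (gam \o g).
have hi : hyp_isometry h.
  by apply: isometry_comp => //; apply: isometry_comp => //; exact: Gg.1.
have hB : h @` B = B.
  by apply: (image_symmetry gK gvK); rewrite -image_comp.
have [phi [bh phi0 _]] := prototile_symmetry d0 hi hB.
have hq0 : h q0 = q0.
  apply: hyp_eqP; first by rewrite bh base_mkhyp phi0.
  by apply: prototile_symmetry_height; rewrite // hB.
have gq0 : gam (g q0) = g q0 by rewrite -[RHS](congr1 g hq0) /h /= gvK.
(* The corner of the [tau] child region that [child_map sg] sends to the axis: -1/2 goes to -1/4 +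
   1/4 = 0. *)
pose r0 : hyp := mkhyp (sgvec tau 2^-1) y1.
have r0E : child_map sg r0 = q0.
  apply: hyp_eqP; rewrite ?base_mkhyp ?height_mkhyp; last by field.
  by apply/rowP => i; rewrite !mxE /= expr0 expr1; field.
have : (g1 @` child_region sg) (g q0).
  rewrite gE; exists (g q0) => //; exists r0; last by rewrite /g1 /= r0E.
  apply/child_regionP; split.
    by apply: orthant_sgvec; apply/andP; split; lra.
  by rewrite height_mkhyp; apply/andP; split; lra.
(* In the [sg] grandchild all coordinates are at least 1/4, so it misses the axis. *)
move=> [r /child_regionP[/orthantP or _]]; rewrite /g1 /= => /(can_inj gK) rq.
have := or (Ordinal d0); have := congr1 (fun p => base p 0 (Ordinal d0)) rq.
rewrite !base_mkhyp !mxE /= expr0 mul1r; lra.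
Qed.

End Orbits.


Theorem mainTheorem3 (R : realType) (d : nat) (hd : (1 <= d)%N)
    (T : set (set (hyp R d))) (hT : B_tiling T) :
  ~ crystallographic T.
Proof.
move=> [D [cD fD]]; apply: (infinitely_many_orbits hd hT).
exact: finitely_many_orbits cD fD.
Qed.
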